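(* For $t\in[T]$ let $L^R_t$ be the Lipschitz modulus under the $1$-norm of $x_{t-1}\mapsto V^R_t(x_{t-1},\xi_t)$ (uniformly over the realizations of $\xi_t$). Suppose that the positive constants $M_t$, $t\in[T]$, used in the upper approximations satisfy $L^R_t\le M_t$ for all $t\in[T]$. Then the lower and upper approximations provide valid bounds for the robust cost-to-go functions: $$\underline V^R_{t+1,i}(x_t,\xi_{t+1})\ \le\ V^R_{t+1}(x_t,\xi_{t+1})\ \le\ \bar V^R_{t+1,i}(x_t,\xi_{t+1})$$ for all $\xi_{t+1}\in\Xi_{t+1}$, all feasible $x_t$, all $t\in[T-1]$ and all iterations $i=1,2,3,\dots$.
   Context: Notation: $[n]=\{1,\dots,n\}$; for vectors $a,b$, $ab$ is the scalar product; for matrices $A\cdot B=\mathrm{tr}(A^\top B)$. Problem data. $T>1$ stages. For $t\in[T]$, $\xi_t=(c_t,b_t,A_t,E_t)$ has finitely many realizations $\xi_{t,j}=(c_{t,j},b_{t,j},A_{t,j},E_{t,j})$, $j\in[K_t]$ (forming $\Xi_t$), of probabilities $p_{t,j}>0$; $\xi_1$ is deterministic and $\xi_1,\dots,\xi_T$ are independent. $\mathcal X_1(x_0,\xi_1)=\{x_1\in\mathbb{R}^{n_1}_+:A_1x_1=b_1\}$ and $\mathcal X_t(x_{t-1},\xi_t)=\{x_t\in\mathbb{R}^{n_t}_+:A_tx_t=b_t-E_tx_{t-1}\}$, $t\ge2$. Relatively complete recourse: $\mathcal X_t(x_{t-1},\xi_t)$ is nonempty and compact for every realization and every feasible $x_{t-1}$;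 $x_t$ is feasible if $x_t\in\mathcal X_t(x_{t-1},\xi_t)$ for some realization $\xi_t$ and some feasible $x_{t-1}$. Preferences. For $t\ge2$, $s_t$ has finite support $\mathcal S_t=\{s_{t,l}\}\subset\mathbb{R}^{d_s}$ and the nonempty ambiguity set is $\mathcal{Q}_{t}=\{q\in\mathbb{R}_+^{|\mathcal S_{t}|}:\sum_{l}q_l=1,\ \sum_l q_l s_{t,l}=\mu_{t},\ \sum_l q_l D_{t,l}=\Sigma_{t}\}$, where $D_{t,l}=(s_{t,l}-\mu_{t})(s_{t,l}-\mu_{t})^\top$ and $\mu_t,\Sigma_t$ are given. Each $\sigma_t(\cdot,s_{t,l}):[0,1)\to\mathbb{R}_+$ is a nondecreasing step function with integral $1$; $\pi_{t,k}=\sum_{i<k}p_{t,i}$, $\psi_{t,l,k}=\int_{\pi_{t,k}}^{\pi_{t,k+1}}\sigma_t(z,s_{t,l})dz$, $\psi_{t,l,0}=0$, $\beta_{t,l,k}=(\psi_{t,l,k}-\psi_{t,l,k-1})(K_t-k+1)$, $\alpha_{t,k}=(k-1)/K_t$. The weights satisfy $\beta_{t,l,k}\ge0$, $\sum_k\beta_{t,l,k}=1$. $\mathrm{CVaR}_\alpha(Z)=\min_{\eta}\{\eta+\frac1{1-\alpha}\mathbb{E}[(Z-\eta)_+]\}$. Robust cost-to-go functions. $V^R_{T+1}\equiv0$ and, for $t=T,\dots,1$, $$V^R_t(x_{t-1},\tilde\xi_t)=\min_{x_t\in\mathcal X_t(x_{t-1},\tilde\xi_t)}\Big\{\tilde c_tx_t+\sup_{q\in\mathcal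 Q_{t+1}}\sum_{k,l}q_l\beta_{t+1,l,k}\mathrm{CVaR}_{\alpha_{t+1,k}}\big(V^R_{t+1}(x_t,\xi_{t+1})\big)\Big\}$$ (second term absent for $t=T$). These are finite at feasible decisions. Common constraint system. For $t<T$, say that $(\zeta,\eta,\Delta)$ with $\zeta=(\zeta^1,\zeta^2,\zeta^3)\in\mathbb{R}\times\mathbb{R}^{d_s}\times\mathbb{R}^{d_s\times d_s}$, $\eta\in\mathbb{R}^{K_{t+1}}$, $\Delta\in\mathbb{R}_+^{K_{t+1}\times K_{t+1}}$ satisfies $(\mathrm C_{t+1})$ if for all $l\in[|\mathcal S_{t+1}|]$ $$\sum_{k}\beta_{t+1,l,k}\Big(\eta_k+\tfrac{1}{1-\alpha_{t+1,k}}\sum_{j}p_{t+1,j}\Delta_{k,j}\Big)-\zeta^1-s_{t+1,l}\zeta^2-\zeta^3\cdot D_{t+1,l}\le0.$$ Lower approximations. $\underline V^R_{T,i}=V^R_T$. For $t<T$, $\underline V^R_{t,i}(x_{t-1},\tilde\xi_t)$ is the infimum of $\tilde c_tx_t+\zeta^1+\mu_{t+1}\zeta^2+\zeta^3\cdot\Sigma_{t+1}$ over $x_t\ge0$ and $(\zeta,\eta,\Delta)$ satisfying $(\mathrm C_{t+1})$, $\tilde A_tx_t=\tilde b_t-\tilde E_tx_{t-1}$, and the cut constraints $g_{t+1,j,n}+G_{t+1,j,n}x_t-\eta_k\le\Delta_{k,j}$ for $k,j\in[K_{t+1}]$ and all cuts $n=0,1,\dots,i$. The cut $n=0$ is initial,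 with $G=0$ and $g$ a constant below the true value function $V^R_{t+1}(\cdot,\xi_{t+1,j})$. Cuts are generated iteratively (SDDP). At iteration $i\ge1$: (forward pass) draw a sample path $(\tilde\xi_2,\dots,\tilde\xi_T)$ of the process and, for $t=1,\dots,T$ successively, let $\hat x^i_t$ be the $x_t$-part of an optimal solution of the problem defining $\underline V^R_{t,i-1}(\hat x^i_{t-1},\tilde\xi_t)$ (with $\hat x_0^i=x_0$); (backward pass) for $t=T,\dots,2$ and each $j\in[K_t]$, solve the problem defining $\underline V^R_{t,i}(\hat x^i_{t-1},\xi_{t,j})$ (which uses the stage-$(t+1)$ cuts already updated in iteration $i$), let $\varrho_{t,j}$ be an optimal Lagrange multiplier (dual solution) of the constraint $A_{t,j}x_t=b_{t,j}-E_{t,j}x_{t-1}$, and add the cut $G_{t,j,i}=-\varrho_{t,j}E_{t,j}$, $g_{t,j,i}=\underline V^R_{t,i}(\hat x^i_{t-1},\xi_{t,j})-G_{t,j,i}\hat x^i_{t-1}$. Upper approximations. $\bar V^R_{T,i}=V^R_T$. For $t<T$, $\bar V^R_{t,i}(x_{t-1},\tilde\xi_t)$ is the infimum of $\tilde c_tx_t+\zeta^1+\mu_{t+1}\zeta^2+\zeta^3\cdot\Sigma_{t+1}$ over $x_t\ge0$, $(\zeta,\eta,\Delta)$ satisfying $(\mathrm C_{t+1})$, $w_j\in\mathbb{R}$, $\theta_{j,n}\ge0$ ($n\in[i]$), $y_j\in\mathbb{R}^{n_t}$ ($j\in[K_{t+1}]$) subject to $\tilde A_tx_t=\tilde b_t-\tilde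 E_tx_{t-1}$, $w_j-\eta_k\le\Delta_{k,j}$ for $k,j\in[K_{t+1}]$, and, for each $j\in[K_{t+1}]$, $$\sum_{n\in[i]}\theta_{j,n}\bar V^R_{t+1,i}(\hat x^n_t,\xi_{t+1,j})+M_{t+1}\|y_j\|_1=w_j,\qquad \sum_{n\in[i]}\theta_{j,n}\hat x^n_t+y_j=x_t,\qquad \sum_{n\in[i]}\theta_{j,n}=1,$$ where $\hat x^n_t$ are the forward-pass decisions above. (For $t=1$ the equality constraint is $A_1x_1=b_1$.) *)

(* Defs.v *)
From HB Require Import structures.
From mathcomp Require Import all_boot all_order all_algebra.
From mathcomp Require Import all_classical all_reals all_analysis.

Set Implicit Arguments.
Unset Strict Implicit.
Unset Printing Implicit Defensive.

Import Order.TTheory GRing.Theory Num.Theory.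
Import numFieldNormedType.Exports.

Local Open Scope classical_set_scope.
Local Open Scope ring_scope.

(* Conventions.  All families are indexed by the stage t : nat; only the
   stages 1..T (2..T for the preference data) carry meaning, and
   [x_t : 'cV_(xdim t)].  Realizations, supports and weights are indexed from 0,
   so that k : 'I_K stands for the 1-based index k + 1. *)

(* tr(A^T B); on column vectors this is the scalar product. *)
Definition mxdot (R : realType) (m n : nat) (A B : 'M[R]_(m, n)) : R :=
  \tr (A^T *m B).

Definition norm1 (R : realType) (n : nat) (x : 'cV[R]_n) : R :=
  \sum_i `|x i 0|.

Definition nonneg_cv (R : realType) (n : nat) (x : 'cV[R]_n) : Prop :=
  forall i, 0 <= x i 0.

(* xi_t = (c_t, b_t, A_t, E_t), with n' = xdim (t - 1). *)
Record realization (R : realType) (m n n' : nat) := Realization {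
  rcost : 'cV[R]_n;
  rrhs : 'cV[R]_m;
  rA : 'M[R]_(m, n);
  rE : 'M[R]_(m, n') }.

Record problem (R : realType) := Problem {
  horizon : nat;
  xdim : nat -> nat;
  nrows : nat -> nat;
  nreal : nat -> nat;
  xi : forall t, 'I_(nreal t) -> realization R (nrows t) (xdim t) (xdim t.-1);
  prob : forall t, 'I_(nreal t) -> R;
  x0 : 'cV[R]_(xdim 0);
  sdim : nat;
  nsupp : nat -> nat;
  supp : forall t, 'I_(nsupp t) -> 'cV[R]_sdim;
  smean : nat -> 'cV[R]_sdim;
  scov : nat -> 'M[R]_sdim;
  sigma : nat -> R -> 'cV[R]_sdim -> R }.

Arguments xi {R} p t _.
Arguments prob {R} p t _.
Arguments supp {R} p t _.
Arguments sigma {R} p t _ _.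

Definition stage_real (R : realType) (D : problem R) (t : nat) :=
  realization R (nrows D t) (xdim D t) (xdim D t.-1).

(* The right-hand side b_t - E_t x_{t-1}, without the second term for t = 1. *)
Definition stage_rhs (R : realType) (D : problem R) (t : nat)
    (x : 'cV[R]_(xdim D t.-1)) (z : stage_real D t) : 'cV[R]_(nrows D t) :=
  if t == 1%N then rrhs z else rrhs z - rE z *m x.

Definition stage_set (R : realType) (D : problem R) (t : nat)
    (x : 'cV[R]_(xdim D t.-1)) (z : stage_real D t) : set 'cV[R]_(xdim D t) :=
  [set y | nonneg_cv y /\ rA z *m y = stage_rhs x z].

Fixpoint feasible (R : realType) (D : problem R) (t : nat) :
    'cV[R]_(xdim D t) -> Prop :=
  match t with
  | 0 => fun x => x = x0 D
  | t'.+1 => fun x => exists x' : 'cV[R]_(xdim D t'), feasible x' /\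
      exists j : 'I_(nreal D t'.+1), stage_set (t := t'.+1) x' (xi D t'.+1 j) x
  end.

(* (s_{t,l} - mu_t)(s_{t,l} - mu_t)^T *)
Definition sdev (R : realType) (D : problem R) (t : nat) (l : 'I_(nsupp D t)) :
    'M[R]_(sdim D) :=
  (supp D t l - smean D t) *m (supp D t l - smean D t)^T.

Definition ambiguity (R : realType) (D : problem R) (t : nat) :
    set ('I_(nsupp D t) -> R) :=
  [set q | [/\ forall l, 0 <= q l, \sum_l q l = 1,
               \sum_l q l *: supp D t l = smean D t &
               \sum_l q l *: sdev l = scov D t]].

Arguments ambiguity {R} D t _.

Definition step_function01 (R : realType) (f : R -> R) : Prop :=
  exists s : seq R, [/\ path <%R 0 s, last 0 s = 1 &
    forall i, (i < size s)%N -> forall x y,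
      x \in `]nth 0 (0 :: s) i, nth 0 s i[ ->
      y \in `]nth 0 (0 :: s) i, nth 0 s i[ -> f x = f y].

(* A nondecreasing step density [0,1) -> R_+; f is irrelevant outside [0,1). *)
Definition spectrum (R : realType) (f : R -> R) : Prop :=
  [/\ forall z, z \in `[0, 1[ -> 0 <= f z,
      {in `[0, 1[ &, {homo f : x y / x <= y}},
      step_function01 f &
      \int[lebesgue_measure]_(z in `[0, 1[) f z = 1].

(* pi_{t,k} and psi_{t,l,k} with the 1-based k of the mathematical notation. *)
Definition cumprob (R : realType) (D : problem R) (t k : nat) : R :=
  \sum_(i < nreal D t | (i.+1 < k)%N) prob D t i.

Definition psi (R : realType) (D : problem R) (t : nat) (l : 'I_(nsupp D t))
    (k : nat) : R :=
  if k is 0 then 0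
  else \int[lebesgue_measure]_(z in `[cumprob D t k, cumprob D t k.+1[)
         sigma D t z (supp D t l).

Definition beta (R : realType) (D : problem R) (t : nat) (l : 'I_(nsupp D t))
    (k : 'I_(nreal D t)) : R :=
  (psi l k.+1 - psi l k) * (nreal D t - k)%:R.

Definition alpha (R : realType) (D : problem R) (t : nat)
    (k : 'I_(nreal D t)) : R :=
  k%:R / (nreal D t)%:R.

(* Extended-real Z, since the cost-to-go functions are +oo where the problem
   is infeasible. *)
Definition CVaR (R : realType) (K : nat) (p : 'I_K -> R) (a : R)
    (Z : 'I_K -> \bar R) : \bar R :=
  ereal_inf [set (eta%:E + ((1 - a)^-1)%:E *
    \sum_(j < K) (p j)%:E * maxe (Z j - eta%:E) 0)%E | eta in [set: R]].

Definition robust_risk (R : realType) (D : problem R) (t : nat)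
    (Z : 'I_(nreal D t) -> \bar R) : \bar R :=
  ereal_sup [set (\sum_(k < nreal D t) \sum_(l < nsupp D t)
    (q l * beta l k)%:E * CVaR (prob D t) (alpha k) Z)%E | q in ambiguity D t].

(* k is the number of stages t, ..., T still to go. *)
Fixpoint cost_to_go_rec (R : realType) (D : problem R) (k t : nat) :
    'cV[R]_(xdim D t.-1) -> stage_real D t -> \bar R :=
  match k with
  | 0 => fun _ _ => 0%E
  | k'.+1 => fun x z =>
      ereal_inf [set ((mxdot (rcost z) y)%:E +
        (if k' is 0 then 0
         else robust_risk (t := t.+1)
                (fun j => cost_to_go_rec k' (t := t.+1) y (xi D t.+1 j))))%E
        | y in stage_set x z]
  end.

Definition cost_to_go (R : realType) (D : problem R) (t : nat) :=
  @cost_to_go_rec R D ((horizon D).+1 - t) t.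

(* Lipschitz modulus under the 1-norm on the effective domain, i.e. the set
   where the (extended-real) cost-to-go function is finite.  The set of feasible
   decisions is a union over realizations and need not be convex, so a modulus
   restricted to it would not control the function on convex combinations of
   forward-pass decisions. *)
Definition lipschitz_modulus (R : realType) (D : problem R) (t : nat) : \bar R :=
  ereal_sup [set r | exists (j : 'I_(nreal D t)) (x y : 'cV[R]_(xdim D t.-1)),
    let V := fun u => cost_to_go u (xi D t j) in
    [/\ V x \is a fin_num, V y \is a fin_num, x != y &
        r = (`|fine (V x) - fine (V y)| / norm1 (x - y))%:E]].

(* Stagewise independence is what makes the cost-to-go functions depend on the
   marginal laws [prob D t] only. *)
Record problem_ok (R : realType) (D : problem R) : Prop := {
  horizon_gt1 : (1 < horizon D)%N;
  prob_gt0 : forall t, (1 <= t <= horizon D)%N -> forall j, 0 < prob D t j;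
  prob_sum1 : forall t, (1 <= t <= horizon D)%N -> \sum_j prob D t j = 1;
  first_deterministic : nreal D 1 = 1%N;
  complete_recourse : forall t, (1 <= t <= horizon D)%N ->
    forall (x : 'cV[R]_(xdim D t.-1)) (j : 'I_(nreal D t)), feasible x ->
      stage_set x (xi D t j) !=set0 /\ compact (stage_set x (xi D t j));
  supp_inj : forall t, (2 <= t <= horizon D)%N -> injective (supp D t);
  ambiguity_nonempty : forall t, (2 <= t <= horizon D)%N ->
    ambiguity D t !=set0;
  sigma_spectrum : forall t, (2 <= t <= horizon D)%N ->
    forall l, spectrum (fun z => sigma D t z (supp D t l));
  beta_ge0 : forall t, (2 <= t <= horizon D)%N ->
    forall (l : 'I_(nsupp D t)) (k : 'I_(nreal D t)), 0 <= beta l k;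
  beta_sum1 : forall t, (2 <= t <= horizon D)%N ->
    forall l : 'I_(nsupp D t), \sum_(k < nreal D t) beta l k = 1 }.

(* The auxiliary variables (zeta, eta, Delta) attached to stage t. *)
Record auxvars (R : realType) (D : problem R) (t : nat) := Auxvars {
  zeta1 : R;
  zeta2 : 'cV[R]_(sdim D);
  zeta3 : 'M[R]_(sdim D);
  eta : 'I_(nreal D t) -> R;
  Delta : 'I_(nreal D t) -> 'I_(nreal D t) -> R }.

Definition pref_constraints (R : realType) (D : problem R) (t : nat)
    (a : auxvars D t) : Prop :=
  (forall k j, 0 <= Delta a k j) /\
  forall l : 'I_(nsupp D t),
    \sum_(k < nreal D t) beta l k *
        (eta a k + (1 - alpha k)^-1 * \sum_j prob D t j * Delta a k j)
      - zeta1 a - mxdot (supp D t l) (zeta2 a) - mxdot (zeta3 a) (sdev l) <= 0.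

Definition approx_objective (R : realType) (D : problem R) (t : nat)
    (z : stage_real D t) (x : 'cV[R]_(xdim D t)) (a : auxvars D t.+1) : R :=
  mxdot (rcost z) x + zeta1 a + mxdot (smean D t.+1) (zeta2 a)
    + mxdot (zeta3 a) (scov D t.+1).

(* The cut n at stage t, realization j is x |-> g t j n + G t j n . x. *)
Record cuts (R : realType) (D : problem R) := Cuts {
  cut_g : forall t, 'I_(nreal D t) -> nat -> R;
  cut_G : forall t, 'I_(nreal D t) -> nat -> 'cV[R]_(xdim D t.-1) }.

Arguments cut_g {R D} c t _ _.
Arguments cut_G {R D} c t _ _.

(* The pairs (x_t, objective value) allowed by all constraints of the problem
   defining the lower approximation except A_t x_t = b_t - E_t x_{t-1}. *)
Definition lower_points (R : realType) (D : problem R) (C : cuts D) (i t : nat)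
    (z : stage_real D t) : set ('cV[R]_(xdim D t) * R) :=
  [set xv | nonneg_cv xv.1 /\
    if t == horizon D then xv.2 = mxdot (rcost z) xv.1
    else exists a : auxvars D t.+1,
      [/\ pref_constraints a,
          forall (k j : 'I_(nreal D t.+1)) n, (n <= i)%N ->
            cut_g C t.+1 j n + mxdot (cut_G C t.+1 j n) xv.1 - eta a k
              <= Delta a k j &
          xv.2 = approx_objective z xv.1 a]].

Definition lower_value (R : realType) (D : problem R) (C : cuts D) (i t : nat)
    (x : 'cV[R]_(xdim D t.-1)) (z : stage_real D t) : \bar R :=
  if t == horizon D then cost_to_go x z
  else ereal_inf [set (xv.2)%:E | xv in
    [set xv | lower_points C i z xv /\ rA z *m xv.1 = stage_rhs x z]].

(* y is the x_t-part of an optimal solution. *)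
Definition lower_optimal (R : realType) (D : problem R) (C : cuts D) (i t : nat)
    (x : 'cV[R]_(xdim D t.-1)) (z : stage_real D t) (y : 'cV[R]_(xdim D t)) :
    Prop :=
  exists v : R, [/\ lower_points C i z (y, v), rA z *m y = stage_rhs x z &
    v%:E = lower_value C i x z].

(* The Lagrangian dual function of the constraint A_t x_t = b_t - E_t x_{t-1}. *)
Definition lower_dual (R : realType) (D : problem R) (C : cuts D) (i t : nat)
    (x : 'cV[R]_(xdim D t.-1)) (z : stage_real D t) (rho : 'cV[R]_(nrows D t)) :
    \bar R :=
  ereal_inf [set (xv.2 + mxdot rho (stage_rhs x z - rA z *m xv.1))%:E
    | xv in lower_points C i z].

Definition optimal_multiplier (R : realType) (D : problem R) (C : cuts D)
    (i t : nat) (x : 'cV[R]_(xdim D t.-1)) (z : stage_real D t)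
    (rho : 'cV[R]_(nrows D t)) : Prop :=
  forall rho', (lower_dual C i x z rho' <= lower_dual C i x z rho)%E.

(* xhat i t is the forward-pass decision of stage t at iteration i >= 1; the
   realizations j chosen by [forward_pass] at stages 2..T form the sample path
   of iteration i. *)
Record sddp_run (R : realType) (D : problem R)
    (xhat : nat -> forall t, 'cV[R]_(xdim D t)) (C : cuts D) : Prop := {
  initial_cut : forall t, (2 <= t <= horizon D)%N -> forall j : 'I_(nreal D t),
    cut_G C t j 0 = 0 /\
    forall x : 'cV[R]_(xdim D t.-1), feasible x ->
      ((cut_g C t j 0)%:E <= cost_to_go x (xi D t j))%E;
  forward_start : forall i, (1 <= i)%N -> xhat i 0 = x0 D;
  forward_pass : forall i, (1 <= i)%N -> forall t, (1 <= t <= horizon D)%N ->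
    exists j : 'I_(nreal D t),
      lower_optimal C i.-1 (xhat i t.-1) (xi D t j) (xhat i t);
  backward_pass : forall i, (1 <= i)%N -> forall t, (2 <= t <= horizon D)%N ->
    forall j : 'I_(nreal D t),
    exists rho : 'cV[R]_(nrows D t),
      [/\ optimal_multiplier C i (xhat i t.-1) (xi D t j) rho,
          cut_G C t j i = - ((rE (xi D t j))^T *m rho) &
          (cut_g C t j i)%:E =
            (lower_value C i (xhat i t.-1) (xi D t j)
              - (mxdot (cut_G C t j i) (xhat i t.-1))%:E)%E] }.

(* k = T - t; the index n : 'I_i stands for iteration n + 1. *)
Fixpoint upper_value_rec (R : realType) (D : problem R) (M : nat -> R)
    (xhat : nat -> forall t, 'cV[R]_(xdim D t)) (i k t : nat) :
    'cV[R]_(xdim D t.-1) -> stage_real D t -> \bar R :=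
  match k with
  | 0 => fun x z => cost_to_go x z
  | k'.+1 => fun x z => ereal_inf [set v | exists (y : 'cV[R]_(xdim D t))
      (a : auxvars D t.+1) (w : 'I_(nreal D t.+1) -> R)
      (theta : 'I_(nreal D t.+1) -> 'I_i -> R)
      (d : 'I_(nreal D t.+1) -> 'cV[R]_(xdim D t)),
      [/\ stage_set x z y, pref_constraints a,
          forall k j, w j - eta a k <= Delta a k j,
          forall j, [/\ forall n, 0 <= theta j n,
            (\sum_(n < i) (theta j n)%:E *
               upper_value_rec M xhat i k' (t := t.+1)
                 (xhat n.+1 t) (xi D t.+1 j)
             + (M t.+1 * norm1 (d j))%:E)%E = (w j)%:E,
            \sum_(n < i) theta j n *: xhat n.+1 t + d j = y &
            \sum_(n < i) theta j n = 1] &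
          v = (approx_objective z y a)%:E]]
  end.

Definition upper_value (R : realType) (D : problem R) (M : nat -> R)
    (xhat : nat -> forall t, 'cV[R]_(xdim D t)) (i t : nat) :=
  @upper_value_rec R D M xhat i (horizon D - t) t.

(* Main.v *)
Require Import Defs.
From HB Require Import structures.
From mathcomp Require Import all_boot all_order all_algebra.
From mathcomp Require Import all_classical all_reals all_analysis.
From mathcomp Require Import ring lra.

Set Implicit Arguments.
Unset Strict Implicit.
Unset Printing Implicit Defensive.

Import Order.TTheory GRing.Theory Num.Theory.
Import numFieldNormedType.Exports.
Local Open Scope ring_scope.

(** The robust risk of a vector of scenario costs is a supremum, over the
polytope of admissible weights, of mixtures of conditional values-at-risk.
Linear programming duality turns it into the minimum of
zeta1 + mu zeta2 + zeta3 . Sigma over the auxiliary variables (zeta, eta, Delta)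
constrained by [pref_constraints] and by Z_j - eta_k <= Delta_kj
([robust_risk_le] and [robust_risk_dual]). The problems defining the two
approximations are therefore the true stage problem with the next cost-to-go
functions replaced, and everything reduces to comparing these replacements
with the true functions, by induction from the last stage backwards.

Lower bound. If every cut of stage t + 1 lies below the true cost-to-go function
at feasible decisions, any decision of the true stage-t problem, completed by
auxiliary variables that certify its risk, is admissible in the approximate
problem, which is hence a relaxation ([lower_value_le]). The approximate problem
is a linear programme, so at an optimal multiplier its Lagrangian is tight at
the trial point; as only the multiplier term depends on the incoming decision,
the resulting cut is a subgradient inequality for the approximate value
([lower_value_subgradient]) and so lies below the true function of stage t.

Upper bound. The constraints on w_j say that w_j is a convex combination of
upper bounds at the trial points plus M times the 1-norm of the remaining
displacement. The true cost-to-go function is convex, because certificates of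
the risk may be averaged, and M-Lipschitz where it is finite, so w_j dominates
its value at the decision ([cost_to_go_interpolation]); weak duality for the
risk then closes the step.

A mixture of feasible decisions need not be feasible, so the value -oo has to be
excluded there before the Lipschitz bound applies. This is what the affine
minorants of the cost-to-go functions are for ([cost_to_go_affine_minorant]):
compactness of a single decision set forces its recession cone to be trivial,
and Farkas' lemma bounds the stage problems from below affinely in the incoming
decision. *)

(** * Linear functionals *)

Section ScalarFunctions.
Variables (R : realFieldType) (V W : lmodType R).
Implicit Types (f g : V -> R).

Lemma scalar_add f g : scalar f -> scalar g -> scalar (fun x => f x + g x).
Proof. by move=> hf hg a u v; rewrite hf hg; ring. Qed.

Lemma scalar_opp f : scalar f -> scalar (fun x => - f x).
Proof. by move=> hf a u v; rewrite hf; ring. Qed.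

Lemma scalar_sub f g : scalar f -> scalar g -> scalar (fun x => f x - g x).
Proof. by move=> hf hg; apply: scalar_add => //; apply: scalar_opp. Qed.

Lemma scalar_scale (c : R) f : scalar f -> scalar (fun x => c * f x).
Proof. by move=> hf a u v; rewrite hf; ring. Qed.

Lemma scalar_sum (I : finType) (F : I -> V -> R) :
  (forall i, scalar (F i)) -> scalar (fun x => \sum_i F i x).
Proof.
move=> hF a u v; rewrite mulr_sumr -big_split /=.
by apply: eq_bigr => i _; rewrite hF.
Qed.

Lemma scalar_comp (f : V -> R) (h : W -> V) :
  scalar f -> linear h -> scalar (fun x => f (h x)).
Proof. by move=> hf hh a u v; rewrite hh hf. Qed.

Lemma scalar0E f : scalar f -> f 0 = 0.
Proof.
move=> hf; have := hf 1 0 0; rewrite scale1r addr0 mul1r => /eqP.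
by rewrite -subr_eq subrr => /eqP.
Qed.

Lemma scalarDE f u v : scalar f -> f (u + v) = f u + f v.
Proof. by move=> hf; have := hf 1 u v; rewrite scale1r mul1r. Qed.

Lemma scalarZE f a u : scalar f -> f (a *: u) = a * f u.
Proof. by move=> hf; have := hf a u 0; rewrite scalar0E // !addr0. Qed.

Lemma scalarNE f u : scalar f -> f (- u) = - f u.
Proof. by move=> hf; rewrite -scaleN1r scalarZE // mulN1r. Qed.

Lemma scalar_combE f (I : finType) (th : I -> R) (x : I -> V) :
  scalar f -> f (\sum_i th i *: x i) = \sum_i th i * f (x i).
Proof.
move=> hf; elim/big_rec2: _ => [|i y1 y2 _ <-]; first exact: scalar0E.
by rewrite hf.
Qed.

End ScalarFunctions.

Section LinearProjections.
Variables (R : realFieldType).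

Lemma linear_comp (U V W : lmodType R) (f : V -> W) (h : U -> V) :
  linear f -> linear h -> linear (fun x => f (h x)).
Proof. by move=> hf hh a u v; rewrite hh hf. Qed.

Lemma linear_fst (V W : lmodType R) : linear (@fst V W).
Proof. by []. Qed.

Lemma linear_snd (V W : lmodType R) : linear (@snd V W).
Proof. by []. Qed.

Lemma linear_eval (I : Type) (V : lmodType R) i : linear (fun f : I -> V => f i).
Proof. by []. Qed.

Lemma scalar_eval (I : Type) i : scalar (fun f : I -> R^o => f i : R).
Proof. by []. Qed.

End LinearProjections.

(** * Farkas' lemma and linear programming duality *)

Section Duality.
Variable R : realFieldType.

(** Bartl's induction: if [g] fails to be nonnegative on the cone cut out by all
functionals but [f ord0], a point [x0] witnessing this has [f ord0 x0 < 0];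
sliding along [x0] onto the kernel of [f ord0] removes that functional, and
the induction hypothesis there lifts back with a nonnegative coefficient. *)
Lemma farkas_ord (V : lmodType R) m (f : 'I_m -> V -> R) (g : V -> R) :
  (forall i, scalar (f i)) -> scalar g ->
  (forall x, (forall i, 0 <= f i x) -> 0 <= g x) ->
  exists2 l : 'I_m -> R, forall i, 0 <= l i &
    forall x, g x = \sum_i l i * f i x.
Proof.
elim: m f g => [|m IHm] f g hf hg fg.
  exists (fun=> 0) => // x; rewrite big_ord0; apply/eqP.
  rewrite eq_le fg ?andbT; last by case.
  rewrite -oppr_ge0 -mulN1r -(scalarZE _ _ hg); apply: fg; by case.
pose f' i := f (lift ord0 i).
have [gf'|] := pselect (forall x, (forall i, 0 <= f' i x) -> 0 <= g x).
  have [l l0 gE] := IHm f' g (fun=> hf _) hg gf'.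
  exists (fun i => if unlift ord0 i is Some j then l j else 0).
    by move=> i; case: (unlift _ _).
  move=> x; rewrite big_ord_recl unlift_none mul0r add0r gE.
  by apply: eq_bigr => i _; rewrite liftK.
move=> /existsNP[x0' /not_implyP[f'x0' /negP]]; rewrite -ltNge => gx0'.
have fx0' : f ord0 x0' < 0.
  rewrite ltNge; apply/negP => f0; move: gx0'; rewrite ltNge => /negP; apply.
  by apply: fg => i; case: (unliftP ord0 i) => [j ->|->//]; exact: f'x0'.
(* The scaling for which [f ord0] takes the value -1. *)
pose c := - (f ord0 x0')^-1; have c0 : 0 < c by rewrite oppr_gt0 invr_lt0.
pose x0 := c *: x0'.
have f0x0 : f ord0 x0 = -1.
  by rewrite /x0 (scalarZE _ _ (hf ord0)) mulNr mulVf // lt_eqF.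
have f'x0 i : 0 <= f' i x0.
  by rewrite /f' /x0 (scalarZE _ _ (hf _)) mulr_ge0 ?(ltW c0) //; exact: f'x0'.
have gx0 : g x0 < 0 by rewrite /x0 (scalarZE _ _ hg) pmulr_rlt0.
pose slide x := f ord0 x *: x0 + x.
have [] := IHm (fun i x => f' i (slide x)) (fun x => g (slide x)).
- move=> i a u v; rewrite /slide /f' !(hf _ _ x0) (hf ord0) (hf _ a u v); ring.
- move=> a u v; rewrite /slide !(hg _ x0) (hf ord0) (hg a u v); ring.
- move=> x f'x; apply: fg => i; case: (unliftP ord0 i) => [j ->|->] //.
    exact: f'x.
  by rewrite /slide (hf _ _ x0) f0x0 mulrN1 addNr.
move=> l l0 gE.
exists (fun i => if unlift ord0 i is Some j then l j
                 else (\sum_i l i * f' i x0) - g x0).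
  move=> i; case: (unlift _ _) => //.
  rewrite subr_ge0 (le_trans (ltW gx0)) //; apply: sumr_ge0 => j _.
  exact: mulr_ge0.
move=> x; rewrite big_ord_recl unlift_none.
under [X in _ = _ + X]eq_bigr do rewrite liftK.
have := gE x; rewrite /= /slide (hg _ x0).
have -> : \sum_i l i * f' i (f ord0 x *: x0 + x) =
    f ord0 x * (\sum_i l i * f' i x0) + \sum_i l i * f (lift ord0 i) x.
  rewrite mulr_sumr -big_split /=; apply: eq_bigr => i _.
  by rewrite /f' (hf _ _ x0) mulrDr mulrCA.
lra.
Qed.

Lemma farkas (V : lmodType R) (I : finType) (f : I -> V -> R) (g : V -> R) :
  (forall i, scalar (f i)) -> scalar g ->
  (forall x, (forall i, 0 <= f i x) -> 0 <= g x) ->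
  exists2 l : I -> R, forall i, 0 <= l i & forall x, g x = \sum_i l i * f i x.
Proof.
move=> hf hg fg.
have [|x fx|l l0 gE] := @farkas_ord V #|I| (fun i => f (enum_val i)) g _ hg.
- by move=> i; apply: hf.
- by apply: fg => i; rewrite -(enum_rankK i).
exists (fun i => l (enum_rank i)) => // x; rewrite gE.
rewrite (@big_enum_val _ _ _ I predT (fun i => l (enum_rank i) * f i x)).
by apply: eq_bigr => i _; rewrite enum_valK.
Qed.

(** Each equation is a pair of opposite inequalities, whence multipliers [rho]
of arbitrary sign; only a lower bound is kept for the inequality part. *)
Lemma farkas_eq (V : lmodType R) (I J : finType) (f : I -> V -> R)
    (h : J -> V -> R) (g : V -> R) :
  (forall i, scalar (f i)) -> (forall j, scalar (h j)) -> scalar g ->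
  (forall x, (forall i, 0 <= f i x) -> (forall j, h j x = 0) -> 0 <= g x) ->
  exists rho : J -> R, forall x, (forall i, 0 <= f i x) ->
    \sum_j rho j * h j x <= g x.
Proof.
move=> hf hh hg fhg.
pose F (k : I + (J + J)) : V -> R := match k with
  | inl i => f i | inr (inl j) => h j | inr (inr j) => fun x => - h j x end.
have [||l l0 gE] := @farkas V _ F g _ hg.
- by move=> [i|[j|j]] //=; apply: scalar_opp.
- move=> x Fx; apply: fhg => [i|j]; first exact: (Fx (inl i)).
  apply/eqP; rewrite eq_le -oppr_ge0.
  by rewrite (Fx (inr (inr j))) (Fx (inr (inl j))).
exists (fun j => l (inr (inl j)) - l (inr (inr j))) => x fx.
rewrite gE big_sumType big_sumType /= -big_split /=.
under [X in _ <= _ + X]eq_bigr do rewrite mulrN -mulrBl.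
by rewrite lerDr; apply: sumr_ge0 => i _; exact: mulr_ge0.
Qed.

(** Homogenising by an extra coordinate [tau >= 0] turns the affine system into
a cone. Where [tau] is positive one rescales; where it vanishes the point is a
recession direction, along which [g] cannot decrease because it is bounded
below on the feasible set. *)
Lemma lagrange_duality (V : lmodType R) (I J : finType)
    (f : I -> V -> R) (b : I -> R) (h : J -> V -> R) (d : J -> R)
    (g : V -> R) (L : R) (x1 : V) :
  (forall i, scalar (f i)) -> (forall j, scalar (h j)) -> scalar g ->
  (forall i, b i <= f i x1) -> (forall j, h j x1 = d j) ->
  (forall x, (forall i, b i <= f i x) -> (forall j, h j x = d j) -> L <= g x) ->
  exists rho : J -> R, forall x, (forall i, b i <= f i x) ->
    L <= g x + \sum_j rho j * (d j - h j x).
Proof.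
move=> hf hh hg fx1 hx1 gL.
pose U : lmodType R := (V * R^o)%type.
have fst_lin : linear (fun u : U => u.1) by [].
have snd_lin (c : R) : scalar (fun u : U => c * (u.2 : R)).
  by apply: scalar_scale => a u v.
have homo_lin (k : V -> R) c : scalar k ->
    scalar (fun u : U => k u.1 - c * (u.2 : R)).
  by move=> hk; apply: scalar_sub => //; apply: scalar_comp.
pose F (i : option I) (u : U) : R :=
  if i is Some i then f i u.1 - b i * (u.2 : R) else 1 * (u.2 : R).
pose H j (u : U) : R := h j u.1 - d j * (u.2 : R).
have [||||rho rhoP] := @farkas_eq U _ _ F H (fun u => g u.1 - L * (u.2 : R)).
- by case=> [i|] /=; [exact: homo_lin|exact: snd_lin].
- by move=> j; exact: homo_lin.
- exact: homo_lin.
- move=> [x tau] /= Fx Hx.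
  have := Fx None; rewrite /= mul1r le_eqVlt => /predU1P[tau0|tau_gt0].
    have {}Fx i : 0 <= f i x by have := Fx (Some i); rewrite /= -tau0 mulr0 subr0.
    have {}Hx j : h j x = 0 by have := Hx j; rewrite /H /= -tau0 mulr0 subr0.
    rewrite -tau0 mulr0 subr0 leNgt; apply/negP => gx.
    (* The step along the recession direction at which [g] drops to [L - 1]. *)
    pose s := (g x1 - L + 1) / - g x.
    have gx1 := gL _ fx1 hx1.
    have s0 : 0 <= s.
      by rewrite divr_ge0 ?oppr_ge0 ?(ltW gx) // addr_ge0 ?subr_ge0.
    have /gL : forall i, b i <= f i (s *: x + x1).
      move=> i; rewrite hf (le_trans (fx1 i)) // lerDr; exact: mulr_ge0.
    have h1 j : h j (s *: x + x1) = d j by rewrite hh Hx mulr0 add0r.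
    move=> /(_ h1); rewrite hg.
    have -> : s * g x = - (g x1 - L + 1).
      by rewrite /s invrN mulrN mulNr divfK // lt_eqF.
    lra.
  have tau_neq0 : tau != 0 by rewrite gt_eqF.
  have /gL : forall i, b i <= f i (tau^-1 *: x).
    move=> i; rewrite (scalarZE _ _ (hf i)) ler_pdivlMl // mulrC.
    by have := Fx (Some i); rewrite /= subr_ge0.
  have h1 j : h j (tau^-1 *: x) = d j.
    rewrite (scalarZE _ _ (hh j)); have /eqP := Hx j.
    by rewrite /H /= subr_eq0 => /eqP ->; rewrite mulrCA mulVf ?mulr1.
  move=> /(_ h1); rewrite (scalarZE _ _ hg) ler_pdivlMl // mulrC.
  by rewrite subr_ge0.
exists rho => x fx.
have /rhoP : forall i, 0 <= F i (x, 1 : R^o).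
  by case=> [i|] /=; rewrite ?mulr1 ?subr_ge0.
rewrite /H /= mulr1.
under eq_bigr do rewrite mulr1 -opprB mulrN.
rewrite sumrN; lra.
Qed.

End Duality.

(** * The entrywise scalar product *)

Section Mxdot.
Variables (R : realType) (m n : nat).
Implicit Types A B : 'M[R]_(m, n).

Lemma mxdotE A B : mxdot A B = \sum_i \sum_j A i j * B i j.
Proof.
rewrite /mxdot /mxtrace exchange_big /=; apply: eq_bigr => j _.
by rewrite mxE; apply: eq_bigr => i _; rewrite mxE.
Qed.

Lemma mxdotC A B : mxdot A B = mxdot B A.
Proof.
rewrite !mxdotE; apply: eq_bigr => i _; apply: eq_bigr => j _; exact: mulrC.
Qed.

Lemma scalar_mxdotr A : scalar (mxdot A).
Proof.
by move=> a u v; rewrite /mxdot mulmxDr -scalemxAr mxtraceD mxtraceZ.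
Qed.

Lemma scalar_mxdotl B : scalar (fun A => mxdot A B).
Proof. by move=> a u v; rewrite !(mxdotC _ B) scalar_mxdotr. Qed.

Lemma mxdot_trmul p (A : 'M[R]_(m, n)) (x : 'M[R]_(n, p)) (y : 'M[R]_(m, p)) :
  mxdot (A^T *m y) x = mxdot y (A *m x).
Proof. by rewrite /mxdot trmx_mul trmxK mulmxA. Qed.

End Mxdot.

Lemma mxdot_cvE (R : realType) n (x y : 'cV[R]_n) :
  mxdot x y = \sum_i x i 0 * y i 0.
Proof. by rewrite mxdotE; apply: eq_bigr => i _; rewrite big_ord1. Qed.

(** * Conditional value-at-risk *)

Section CVaRTheory.
Variables (R : realType) (K : nat) (p : 'I_K -> R) (a : R).
Hypotheses (p_ge0 : forall j, 0 <= p j) (a_lt1 : a < 1).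

Let c_ge0 : (0 <= ((1 - a)^-1)%:E)%E.
Proof. by rewrite lee_fin invr_ge0 subr_ge0 ltW. Qed.

Lemma CVaR_le (Z : 'I_K -> \bar R) (e : R) (d : 'I_K -> R) :
  (forall j, 0 <= d j) -> (forall j, (Z j <= (e + d j)%:E)%E) ->
  (CVaR p a Z <= (e + (1 - a)^-1 * \sum_j p j * d j)%:E)%E.
Proof.
move=> d0 Zd; apply: ge_ereal_inf; eexists; first by exists e.
rewrite EFinD EFinM -sumEFin leeD2l //; apply: lee_wpmul2l => //.
apply: lee_sum => j _; rewrite EFinM; apply: lee_wpmul2l => //.
  by rewrite lee_fin.
by rewrite ge_max lee_fin d0 andbT leeBlDl // -EFinD.
Qed.

(** The expectation is a lower bound because
[eta + (1 - a)^-1 * (z - eta)_+ >= z] whenever [0 <= a < 1]. *)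
Lemma CVaR_ge (Z : 'I_K -> \bar R) (m : 'I_K -> R) :
  0 <= a -> \sum_j p j = 1 -> (forall j, ((m j)%:E <= Z j)%E) ->
  ((\sum_j p j * m j)%:E <= CVaR p a Z)%E.
Proof.
move=> a0 p1 mZ; apply: le_ereal_inf_tmp => _ [e _ <-].
apply: (@le_trans _ _ (e + (1 - a)^-1 *
    \sum_j p j * Num.max (m j - e) 0)%:E).
  have c1 : 1 <= (1 - a)^-1.
    by rewrite invf_ge1 ?subr_gt0 // lerBlDr lerDl.
  rewrite lee_fin -[X in X + _]mul1r -{1}p1 mulr_suml mulr_sumr -big_split /=.
  apply: ler_sum => j _.
  rewrite mulrCA -mulrDr ler_wpM2l //.
  have h0 : 0 <= Num.max (m j - e) 0 by rewrite le_max lexx orbT.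
  rewrite -lerBlDl (le_trans _ (ler_peMl h0 c1)) //.
  by rewrite le_max lexx.
rewrite EFinD EFinM -sumEFin leeD2l //; apply: lee_wpmul2l => //.
apply: lee_sum => j _; rewrite EFinM; apply: lee_wpmul2l => //.
  by rewrite lee_fin.
rewrite EFin_max ge_max; apply/andP; split; rewrite le_max ?lexx ?orbT //.
by rewrite EFinB leeB ?mZ.
Qed.

Lemma CVaR_near_optimal (z : 'I_K -> R) (eps : R) :
  0 <= a -> \sum_j p j = 1 -> 0 < eps ->
  exists e : R,
    ((e + (1 - a)^-1 * \sum_j p j * Num.max (z j - e) 0)%:E
      <= CVaR p a (fun j => (z j)%:E) + eps%:E)%E.
Proof.
move=> a0 p1 eps0.
have fin : CVaR p a (fun j => (z j)%:E) \is a fin_num.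
  rewrite fin_numE; apply/andP; split; rewrite -?ltNye -?ltey.
    by apply: lt_le_trans (CVaR_ge a0 p1 (fun j => lexx _)); rewrite ltNyr.
  apply: le_lt_trans (@CVaR_le _ 0 (fun j => Num.max (z j) 0) _ _) _.
  - by move=> j; rewrite le_max lexx orbT.
  - by move=> j; rewrite lee_fin add0r le_max lexx.
  - by rewrite ltry.
have [_ [e _ <-] /ltW he] := lb_ereal_inf_adherent eps0 fin.
exists e; apply: le_trans he.
rewrite EFinD EFinM -sumEFin leeD2l //; apply: lee_wpmul2l => //.
by apply: lee_sum => j _; rewrite EFinM EFin_max EFinB.
Qed.

End CVaRTheory.

(** * The robust risk as a linear programme *)

Lemma alpha_ge0 (R : realType) (D : problem R) t (k : 'I_(nreal D t)) :
  0 <= alpha k.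
Proof. by rewrite /alpha divr_ge0. Qed.

Lemma alpha_lt1 (R : realType) (D : problem R) t (k : 'I_(nreal D t)) :
  alpha k < 1.
Proof.
rewrite /alpha ltr_pdivrMr ?mul1r ?ltr_nat ?ltn_ord //.
by rewrite ltr0n (leq_ltn_trans _ (ltn_ord k)).
Qed.

(** The objective of the linear programme dual to the worst-case expectation
over the ambiguity set. *)
Definition aux_value (R : realType) (D : problem R) (t : nat)
    (a : auxvars D t) : R :=
  zeta1 a + mxdot (smean D t) (zeta2 a) + mxdot (zeta3 a) (scov D t).

Lemma approx_objectiveE (R : realType) (D : problem R) t (z : stage_real D t)
    x (a : auxvars D t.+1) :
  approx_objective z x a = mxdot (rcost z) x + aux_value a.
Proof. by rewrite /approx_objective /aux_value !addrA. Qed.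

Lemma ge0_of_multiples (R : realFieldType) (C k : R) :
  (forall s, 0 <= s -> C <= s * k) -> 0 <= k.
Proof.
move=> Ck; rewrite leNgt; apply/negP => k0.
have C0 : C <= 0 by rewrite -(mul0r k) Ck.
have := Ck ((1 - C) / - k); rewrite divr_ge0 ?oppr_ge0 ?(ltW k0) //; last lra.
rewrite invrN mulrN mulNr divfK ?lt_eqF // => /(_ isT); lra.
Qed.

Section RobustRisk.
Variables (R : realType) (D : problem R) (t : nat).
Hypotheses (D_ok : problem_ok D) (t_range : (2 <= t <= horizon D)%N).

Let t_range1 : (1 <= t <= horizon D)%N.
Proof. by case/andP: t_range => /ltnW ->. Qed.

Let p_ge0 j : 0 <= prob D t j := ltW (prob_gt0 D_ok t_range1 j).
Let p1 : \sum_j prob D t j = 1 := prob_sum1 D_ok t_range1.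

Lemma ambiguity_beta_sum1 q : ambiguity D t q ->
  \sum_(k < nreal D t) \sum_(l < nsupp D t) q l * beta l k = 1.
Proof.
case=> _ q1 _ _; rewrite exchange_big -[RHS]q1 /=; apply: eq_bigr => l _.
by rewrite -mulr_sumr (beta_sum1 D_ok t_range) mulr1.
Qed.

Lemma ambiguity_beta_ge0 q l (k : 'I_(nreal D t)) :
  ambiguity D t q -> 0 <= q l * beta l k.
Proof. by case=> q0 _ _ _; rewrite mulr_ge0 ?q0 ?(beta_ge0 D_ok). Qed.

Lemma ambiguity_dual_value q (a : auxvars D t) : ambiguity D t q ->
  \sum_l q l * (zeta1 a + mxdot (supp D t l) (zeta2 a)
                + mxdot (zeta3 a) (sdev l)) = aux_value a.
Proof.
case=> _ q1 qs qd; rewrite /aux_value -qs -qd.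
rewrite (scalar_combE _ _ (@scalar_mxdotl _ _ _ (zeta2 a))).
rewrite (scalar_combE _ _ (@scalar_mxdotr _ _ _ (zeta3 a))).
rewrite -[X in X + _ + _]mul1r -q1 mulr_suml -!big_split /=.
by apply: eq_bigr => l _; rewrite !mulrDr.
Qed.

(** Weak duality: the thresholds [eta] bound the conditional values-at-risk, and
averaging the constraints with the weights [q] replaces the moments of single
support points by the prescribed ones. *)
Lemma robust_risk_le (Z : 'I_(nreal D t) -> \bar R) (a : auxvars D t) :
  pref_constraints a ->
  (forall k j, (Z j <= (Defs.eta a k + Delta a k j)%:E)%E) ->
  (robust_risk Z <= (aux_value a)%:E)%E.
Proof.
move=> [Delta0 prefa] Za; apply: ge_ereal_sup => _ [q Qq <-].
pose u k := Defs.eta a k + (1 - alpha k)^-1 * \sum_j prob D t j * Delta a k j.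
apply: (@le_trans _ _ (\sum_k \sum_l q l * beta l k * u k)%:E).
  rewrite -sumEFin; apply: lee_sum => k _.
  rewrite -sumEFin; apply: lee_sum => l _.
  rewrite [leRHS]EFinM; apply: lee_wpmul2l; first by rewrite lee_fin ambiguity_beta_ge0.
  by apply: CVaR_le => //; exact: alpha_lt1.
rewrite lee_fin -(ambiguity_dual_value _ Qq) exchange_big /=.
apply: ler_sum => l _.
under eq_bigr do rewrite -mulrA.
rewrite -mulr_sumr ler_wpM2l //; first by case: Qq.
have := prefa l; rewrite -/(u _); lra.
Qed.

(** All risk levels dominate the expectation, and the weights
[q l * beta l k] sum to one. *)
Lemma robust_risk_ge (Z : 'I_(nreal D t) -> \bar R) (m : 'I_(nreal D t) -> R) :
  (forall j, ((m j)%:E <= Z j)%E) ->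
  ((\sum_j prob D t j * m j)%:E <= robust_risk Z)%E.
Proof.
move=> mZ; have [q Qq] := ambiguity_nonempty D_ok t_range.
apply: (@le_trans _ _ (\sum_(k < nreal D t) \sum_(l < nsupp D t)
    (q l * beta l k)%:E * CVaR (prob D t) (alpha k) Z)%E); last first.
  by apply: ereal_sup_ubound; exists q.
rewrite -[X in X%:E]mul1r -(ambiguity_beta_sum1 Qq) mulr_suml.
rewrite -sumEFin; apply: lee_sum => k _.
rewrite mulr_suml -sumEFin; apply: lee_sum => l _.
rewrite [leLHS]EFinM; apply: lee_wpmul2l; first by rewrite lee_fin ambiguity_beta_ge0.
by apply: CVaR_ge => //; [exact: alpha_lt1|exact: alpha_ge0].
Qed.

(** Every scenario has positive probability, so an infinite cost in one of them
would push the expectation, hence the risk, above any bound. *)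
Lemma robust_risk_fin (Z : 'I_(nreal D t) -> \bar R)
    (m : 'I_(nreal D t) -> R) (r : R) :
  (forall j, ((m j)%:E <= Z j)%E) -> (robust_risk Z <= r%:E)%E ->
  exists z : 'I_(nreal D t) -> R, Z = (fun j => (z j)%:E).
Proof.
move=> mZ Zr; exists (fun j => fine (Z j)); apply: funext => j0.
rewrite fineK // fin_numE; apply/andP; split.
  by rewrite -ltNye (lt_le_trans _ (mZ j0)) ?ltNyr.
apply/eqP => Zj0.
(* Replacing the infinite cost by [s] makes the expectation equal to [r + 1]. *)
pose rest := \sum_(j | j != j0) prob D t j * m j.
pose s := (r - rest + 1) / prob D t j0.
have /robust_risk_ge : forall j,
    ((if j == j0 then s else m j)%:E <= Z j)%E.
  by move=> j; case: eqP => [->|_]; rewrite ?Zj0 ?leey.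
move=> /le_trans/(_ Zr); rewrite lee_fin (bigD1 j0) //= eqxx.
under eq_bigr => j /negPf -> do [].
rewrite -/rest /s mulrC divfK; first lra.
by rewrite gt_eqF // (prob_gt0 D_ok).
Qed.

(** Strong duality. Near-optimal thresholds [eta] reduce each risk level to a
number, and the supremum over the ambiguity set becomes a linear programme in
[q]; the multipliers of its moment constraints are the [- zeta]. *)
Lemma robust_risk_dual (z : 'I_(nreal D t) -> R) (r eps : R) :
  (robust_risk (fun j => (z j)%:E) <= r%:E)%E -> 0 < eps ->
  exists a : auxvars D t, [/\ pref_constraints a,
    forall k j, z j - Defs.eta a k <= Delta a k j & aux_value a <= r + eps].
Proof.
move=> zr eps0.
have [e eP] := choice (fun k : 'I_(nreal D t) => CVaR_near_optimal p_ge0 (alpha_lt1 k) z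
  (alpha_ge0 k) p1 eps0).
pose u k := e k + (1 - alpha k)^-1 *
  \sum_j prob D t j * Num.max (z j - e k) 0.
pose v l := \sum_k beta l k * u k.
pose d := sdim D; pose L := nsupp D t.
pose V : lmodType R := 'I_L -> R^o.
(* The moments constrained in the ambiguity set: mass, mean and covariance. *)
pose moment (y : 'cV[R]_d) (Y : 'M[R]_d)
    (j : 'I_1 + ('I_d + 'I_d * 'I_d)) : R := match j with
  | inl _ => 1 | inr (inl i) => y i 0 | inr (inr ij) => Y ij.1 ij.2 end.
pose h j (q : V) : R := \sum_l moment (supp D t l) (sdev l) j * (q l : R).
pose b := moment (smean D t) (scov D t).
have coord l : scalar (fun q : V => q l : R) by move=> c x y.
have hQ (q : V) : (forall l, 0 <= (q l : R)) -> (forall j, h j q = b j) <->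
    ambiguity D t q.
  move=> q0; split=> [hq|[_ q1 qs qd] [i0|[i|ij]]]; rewrite /h /b /=.
  - split=> //.
    + by rewrite -[RHS](hq (inl ord0)); apply: eq_bigr => l _; rewrite mul1r.
    + apply/colP => i; rewrite summxE -[RHS](hq (inr (inl i))).
      by apply: eq_bigr => l _; rewrite mxE mulrC.
    + apply/matrixP => i j; rewrite summxE -[RHS](hq (inr (inr (i, j)))).
      by apply: eq_bigr => l _; rewrite mxE mulrC.
  - by rewrite -[RHS]q1; apply: eq_bigr => l _; rewrite mul1r.
  - rewrite -[in RHS]qs summxE.
    by apply: eq_bigr => l _; rewrite mxE mulrC.
  - rewrite -[in RHS]qd summxE.
    by apply: eq_bigr => l _; rewrite [in RHS]mxE mulrC.
have [q0 Qq0] := ambiguity_nonempty D_ok t_range.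
have [||||q q_ge0 /(hQ _ q_ge0) Qq|rho rhoP] := @lagrange_duality R V
    'I_L _ (fun l q => q l) (fun=> 0) h b (fun q => - \sum_l v l * (q l : R))
    (- (r + eps)) q0 coord.
- by case=> [i0|[i|ij]]; apply: scalar_sum => l; exact: scalar_scale.
- by apply/scalar_opp/scalar_sum => l; exact: scalar_scale.
- by case: Qq0.
- by apply/hQ => //; case: Qq0.
- rewrite lerN2.
  have : (\sum_k \sum_l (q l * beta l k)%:E * ((u k)%:E - eps%:E) <= r%:E)%E.
    apply: le_trans zr; apply: le_trans; last first.
      by apply: ereal_sup_ubound; exists q.
    apply: lee_sum => k _; apply: lee_sum => l _.
    apply: lee_wpmul2l; first by rewrite lee_fin ambiguity_beta_ge0.
    by rewrite leeBlDr // eP.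
  under eq_bigr => k _ do under eq_bigr => l _ do rewrite -EFinB -EFinM.
  under eq_bigr => k _ do rewrite sumEFin.
  rewrite sumEFin lee_fin.
  suff -> : \sum_k \sum_l q l * beta l k * (u k - eps) =
      (\sum_l v l * (q l : R)) - eps by lra.
  rewrite -[X in _ - X]mul1r -(ambiguity_beta_sum1 Qq) exchange_big /=.
  rewrite [X in X * eps]exchange_big /= mulr_suml -sumrB.
  apply: eq_bigr => l _; rewrite /v !mulr_suml -sumrB.
  by apply: eq_bigr => k _; ring.
pose a := @Auxvars R D t (- rho (inl ord0)) (\col_i - rho (inr (inl i)))
  (\matrix_(i, j) - rho (inr (inr (i, j)))) e
  (fun k j => Num.max (z j - e k) 0).
have rho_moment y Y : \sum_j rho j * moment y Y j =
    - (zeta1 a + mxdot y (zeta2 a) + mxdot (zeta3 a) Y).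
  rewrite big_sumType big_sumType /= big_ord1 mulr1 !opprD addrA /= opprK.
  congr (_ + _ + _).
    by rewrite mxdot_cvE -sumrN; apply: eq_bigr => i _; rewrite mxE; ring.
  rewrite mxdotE -sumrN; under [RHS]eq_bigr do rewrite -sumrN.
  rewrite pair_bigA /=; apply: eq_bigr => -[i j] _ /=; rewrite mxE; ring.
have rho_h q : \sum_j rho j * h j q = - \sum_l (q l : R) *
    (zeta1 a + mxdot (supp D t l) (zeta2 a) + mxdot (zeta3 a) (sdev l)).
  under eq_bigr do rewrite mulr_sumr.
  rewrite exchange_big -sumrN /=; apply: eq_bigr => l _.
  rewrite -mulrN -rho_moment mulr_sumr; apply: eq_bigr => j _; ring.
have {}rhoP (q : V) : (forall l, 0 <= (q l : R)) -> - (r + eps) <=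
    - aux_value a + \sum_l (q l : R) * (zeta1 a + mxdot (supp D t l) (zeta2 a)
      + mxdot (zeta3 a) (sdev l) - v l).
  move=> /rhoP; have -> : \sum_j rho j * (b j - h j q) =
      \sum_j rho j * b j - \sum_j rho j * h j q.
    by rewrite -sumrB; apply: eq_bigr => j _; rewrite mulrBr.
  rewrite rho_h /b rho_moment -/(aux_value a).
  rewrite opprK addrCA => /le_trans; apply; rewrite lerD2l addrC -sumrB.
  by apply: ler_sum => l _; rewrite mulrBr (mulrC (v l)).
exists a; split.
- split=> [k j|l]; first by rewrite le_max lexx orbT.
  rewrite -[\sum_k _]/(v l).
  suff : 0 <= zeta1 a + mxdot (supp D t l) (zeta2 a)
    + mxdot (zeta3 a) (sdev l) - v l by lra.
  (* The Lagrangian bound along the ray spanned by the [l]-th unit vector. *)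
  apply: (@ge0_of_multiples _ (aux_value a - (r + eps))) => s s0.
  have /(_ (fun i => if i == l then s else 0)) := rhoP.
  rewrite (bigD1 l) //= eqxx big1 => [|i /negPf ->]; last by rewrite mul0r.
  have h0 : forall i, 0 <= (if i == l then s else 0) by move=> i; case: ifP.
  move=> /(_ h0); lra.
- by move=> k j; rewrite le_max lexx.
- (* The Lagrangian bound at [q = 0] is the bound on the dual objective. *)
  have := rhoP (fun=> 0) (fun=> lexx _).
  rewrite big1 => [|l _]; last by rewrite mul0r.
  lra.
Qed.

End RobustRisk.

(** The auxiliary variables as a vector space, so that every constraint on them
is given by a linear functional. *)
Definition aux_space (R : realType) (D : problem R) (t : nat) : lmodType R :=
  (R^o * 'cV[R]_(sdim D) * 'M[R]_(sdim D) * ('I_(nreal D t) -> R^o)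
   * ('I_(nreal D t) -> 'I_(nreal D t) -> R^o))%type.

Section AuxSpace.
Variables (R : realType) (D : problem R) (t : nat).

Definition aux_of (w : aux_space D t) : auxvars D t :=
  Auxvars w.1.1.1.1 w.1.1.1.2 w.1.1.2 w.1.2 w.2.

Definition aux_vec (a : auxvars D t) : aux_space D t :=
  (zeta1 a, zeta2 a, zeta3 a, Defs.eta a, Delta a).

Lemma aux_vecK : cancel aux_vec aux_of.
Proof. by case. Qed.

Definition pref_lhs (l : 'I_(nsupp D t)) (a : auxvars D t) : R :=
  \sum_(k < nreal D t) beta l k *
      (Defs.eta a k + (1 - alpha k)^-1 * \sum_j prob D t j * Delta a k j)
    - zeta1 a - mxdot (supp D t l) (zeta2 a) - mxdot (zeta3 a) (sdev l).

Lemma linear_aux4 : linear (fun w : aux_space D t => w.1).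
Proof. exact: linear_fst. Qed.

Lemma linear_aux3 : linear (fun w : aux_space D t => w.1.1).
Proof. exact (linear_comp (@linear_fst _ _ _) linear_aux4). Qed.

Lemma linear_aux2 : linear (fun w : aux_space D t => w.1.1.1).
Proof. exact (linear_comp (@linear_fst _ _ _) linear_aux3). Qed.

Lemma scalar_Delta k j : scalar (fun w => Delta (aux_of w) k j).
Proof.
apply: (scalar_comp (scalar_eval j) (linear_comp (linear_eval k) _)).
exact: linear_snd.
Qed.

Lemma scalar_eta k : scalar (fun w => Defs.eta (aux_of w) k).
Proof.
exact (scalar_comp (scalar_eval k) (linear_comp (@linear_snd _ _ _) linear_aux4)).
Qed.

Lemma scalar_zeta3 S : scalar (fun w => mxdot (zeta3 (aux_of w)) S).
Proof.
apply: (scalar_comp (@scalar_mxdotl _ _ _ S)).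
exact (linear_comp (@linear_snd _ _ _) linear_aux3).
Qed.

Lemma scalar_zeta2 s : scalar (fun w => mxdot s (zeta2 (aux_of w))).
Proof.
apply: (scalar_comp (@scalar_mxdotr _ _ _ s)).
exact (linear_comp (@linear_snd _ _ _) linear_aux2).
Qed.

Lemma scalar_zeta1 : scalar (fun w => zeta1 (aux_of w)).
Proof. exact (linear_comp (@linear_fst _ _ _) linear_aux2). Qed.

Lemma scalar_aux_value : scalar (fun w => aux_value (aux_of w)).
Proof.
rewrite /aux_value; apply: scalar_add; last exact: scalar_zeta3.
by apply: scalar_add; [exact: scalar_zeta1|exact: scalar_zeta2].
Qed.

Lemma scalar_pref_lhs l : scalar (fun w => pref_lhs l (aux_of w)).
Proof.
rewrite /pref_lhs; apply: scalar_sub; last exact: scalar_zeta3.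
apply: scalar_sub; last exact: scalar_zeta2.
apply: scalar_sub; last exact: scalar_zeta1.
apply: scalar_sum => k; apply: scalar_scale; apply: scalar_add.
  exact: scalar_eta.
apply: scalar_scale; apply: scalar_sum => j; apply: scalar_scale.
exact: scalar_Delta.
Qed.

End AuxSpace.

(** * The true cost-to-go functions *)

Section CostToGo.
Variables (R : realType) (D : problem R).
Hypothesis D_ok : problem_ok D.

Definition future_cost (t : nat) (y : 'cV[R]_(xdim D t)) : \bar R :=
  if t == horizon D then 0%E
  else robust_risk (t := t.+1)
    (fun j => cost_to_go (t := t.+1) y (xi D t.+1 j)).

Lemma cost_to_goE t (x : 'cV[R]_(xdim D t.-1)) (z : stage_real D t) :
  (t <= horizon D)%N ->
  cost_to_go x z = ereal_inf [set ((mxdot (rcost z) y)%:E + future_cost y)%E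
                             | y in stage_set x z]%classic.
Proof.
move=> tT; rewrite /cost_to_go subSn //= /future_cost /cost_to_go subSS.
have -> : (t == horizon D) = (horizon D - t == 0)%N.
  by rewrite subn_eq0 eqn_leq tT.
by case: (horizon D - t)%N.
Qed.

Lemma feasible_stage t (x : 'cV[R]_(xdim D t.-1)) j (y : 'cV[R]_(xdim D t)) :
  (1 <= t)%N -> feasible x -> stage_set x (xi D t j) y -> feasible y.
Proof. by case: t x j y => // t x j y _ fx xy; exists x; split=> //; exists j. Qed.

Lemma feasible_exists t : (t <= horizon D)%N ->
  exists x : 'cV[R]_(xdim D t), feasible x.
Proof.
elim: t => [_|t IHt tT]; first by exists (x0 D).
have [x fx] := IHt (ltnW tT).
have [j] : exists j : 'I_(nreal D t.+1), True.
  have := @prob_sum1 _ _ D_ok t.+1 tT.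
  case: (nreal D t.+1) (prob D t.+1) => [p|n _ _]; last by exists ord0.
  by rewrite big_ord0 => /eqP; rewrite eq_sym oner_eq0.
have [[y xy] _] := complete_recourse D_ok (t := t.+1) tT j fx.
by exists y, x; split => //; exists j.
Qed.

(** A nonzero direction would make the (compact) decision set at any feasible
point unbounded; the recession cone does not depend on that point. *)
Lemma recession_cone_trivial t (j : 'I_(nreal D t)) (h : 'cV[R]_(xdim D t)) i :
  (1 <= t <= horizon D)%N ->
  nonneg_cv h -> rA (xi D t j) *m h = 0 -> h i 0 <= 0.
Proof.
move=> t_range h0 Ah; case/andP: (t_range) => t1 tT.
have [x fx] := feasible_exists (leq_trans (leq_pred t) tT).
have [[y [y0 Ay]] compS] := complete_recourse D_ok t_range j fx.
have : compact ((fun u : 'cV[R]_(xdim D t) => u i 0 : R^o)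
                  @` stage_set x (xi D t j))%classic.
  apply: continuous_compact compS; apply: continuous_subspaceT.
  exact: coord_continuous.
move=> /compact_bounded[M0 [_ /(_ (M0 + 1))]].
rewrite ltrDl ltr01 => /(_ isT) MP; set M := M0 + 1 in MP.
rewrite -oppr_ge0; apply: (@ge0_of_multiples _ (y i 0 - M)) => s s0.
suff : `|(y + s *: h) i 0| <= M.
  by rewrite !mxE => /(le_trans (ler_norm _)); lra.
apply: MP; exists (y + s *: h) => //; split.
  by move=> k; rewrite !mxE addr_ge0 ?y0 // mulr_ge0.
by rewrite mulmxDr -scalemxAr Ah scaler0 addr0.
Qed.

(** On the nonnegative orthant the triviality of the recession cone is, by Farkas'
lemma, the dual feasibility of the stage problem for every cost vector [v]. *)
Lemma stage_linear_minorant t (j : 'I_(nreal D t)) (v : 'cV[R]_(xdim D t)) :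
  (1 <= t <= horizon D)%N ->
  exists rho : 'cV[R]_(nrows D t), forall y, nonneg_cv y ->
    mxdot rho (rA (xi D t j) *m y) <= mxdot v y.
Proof.
move=> t_range.
have coord n (i : 'I_n) : scalar (fun y : 'cV[R]_n => y i 0).
  by move=> a u w; rewrite !mxE.
have [||||rho rhoP] := @farkas_eq R 'cV[R]_(xdim D t) _ _
    (fun i y => y i 0) (fun i y => (rA (xi D t j) *m y) i 0) (mxdot v).
- exact: coord.
- move=> i; apply: (scalar_comp (coord _ i)).
  by move=> a u w; rewrite mulmxDr scalemxAr.
- exact: scalar_mxdotr.
- move=> y y0 Ay; rewrite mxdot_cvE big1 // => i _.
  have yi0 : y i 0 <= 0.
    apply: (recession_cone_trivial (j := j)) => //.
    by apply/colP => k; rewrite Ay mxE.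
  suff -> : y i 0 = 0 by rewrite mulr0.
  by apply/eqP; rewrite eq_le yi0 y0.
exists (\col_i rho i) => y y0; rewrite mxdot_cvE; apply: le_trans (rhoP y y0).
by apply: ler_sum => i _; rewrite mxE.
Qed.

Lemma stage_affine_minorant t (j : 'I_(nreal D t)) (e : R)
    (f : 'cV[R]_(xdim D t)) :
  (1 <= t <= horizon D)%N ->
  (forall y, ((e + mxdot f y)%:E <= future_cost y)%E) ->
  exists (g : R) (G : 'cV[R]_(xdim D t.-1)), forall x,
    ((g + mxdot G x)%:E <= cost_to_go x (xi D t j))%E.
Proof.
move=> t_range efP; have tT : (t <= horizon D)%N by case/andP: t_range.
set z := xi D t j.
have [rho rhoP] := stage_linear_minorant j (rcost z + f) t_range.
exists (e + mxdot rho (rrhs z)), (if t == 1%N then 0 else - ((rE z)^T *m rho)).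
move=> x; rewrite cost_to_goE //; apply: le_ereal_inf_tmp => _ [y [y0 Ay] <-].
apply: le_trans (leeD2l _ (efP y)); rewrite -EFinD lee_fin.
have := rhoP y y0; rewrite -/z Ay /stage_rhs (scalarDE _ _ (scalar_mxdotl y)).
case: ifP => _.
  rewrite (scalar0E (scalar_mxdotl x)); lra.
rewrite (scalarDE _ _ (scalar_mxdotr rho)) (scalarNE _ (scalar_mxdotr rho)).
rewrite (scalarNE _ (scalar_mxdotl x)) mxdot_trmul; lra.
Qed.

(** By induction from the last stage: an affine minorant of the next stage passes
through the risk measure, which dominates the expectation, and then through
the minimisation, because the recession cone is trivial. *)
Lemma cost_to_go_affine_minorant t (j : 'I_(nreal D t)) :
  (1 <= t <= horizon D)%N ->
  exists (g : R) (G : 'cV[R]_(xdim D t.-1)), forall x,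
    ((g + mxdot G x)%:E <= cost_to_go x (xi D t j))%E.
Proof.
move=> /andP[t1 tT].
have [k tk] : exists k, (t + k = horizon D)%N.
  by exists (horizon D - t)%N; rewrite subnKC.
elim: k t tk t1 tT j => [|k IHk] t tk t1 tT j.
  apply: (@stage_affine_minorant t j 0 0); rewrite ?t1 // => y.
  rewrite /future_cost -tk addn0 eqxx lee_fin add0r.
  by rewrite (scalar0E (scalar_mxdotl y)).
have t_lt : (t < horizon D)%N by rewrite -tk addnS ltnS leq_addr.
have tS_range : (2 <= t.+1 <= horizon D)%N by rewrite ltnS t1.
have [|g gP] := choice (IHk t.+1 _ isT t_lt); first by rewrite addSn -addnS.
have [G GP] := choice gP.
apply: (@stage_affine_minorant t j (\sum_i prob D t.+1 i * g i)
  (\sum_i prob D t.+1 i *: G i)); rewrite ?t1 // => y.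
rewrite /future_cost (ltn_eqF t_lt) (scalar_combE _ _ (scalar_mxdotl y)).
rewrite -big_split /=; under eq_bigr do rewrite -mulrDr.
by apply: robust_risk_ge => // i; exact: GP.
Qed.

Lemma future_cost_gtNy t (y : 'cV[R]_(xdim D t)) :
  (1 <= t <= horizon D)%N -> (-oo < future_cost y)%E.
Proof.
move=> /andP[t1 tT]; rewrite /future_cost; case: eqVneq => [_|t_neq].
  by rewrite ltNy0.
have t_lt : (t < horizon D)%N by rewrite ltn_neqAle t_neq.
have tS_range : (2 <= t.+1 <= horizon D)%N by rewrite ltnS t1.
have [g gP] := choice (fun j => @cost_to_go_affine_minorant t.+1 j t_lt).
have [G GP] := choice gP.
by apply: lt_le_trans (robust_risk_ge D_ok tS_range (GP^~ y)); rewrite ltNyr.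
Qed.

(** Any family of finite scenario costs is covered by suitable auxiliary
variables, so a finite cost in every scenario gives a finite risk. *)
Lemma robust_risk_lty t (Z : 'I_(nreal D t) -> \bar R)
    (m : 'I_(nreal D t) -> R) :
  (2 <= t <= horizon D)%N -> (forall j, (Z j <= (m j)%:E)%E) ->
  (robust_risk Z < +oo)%E.
Proof.
move=> t_range Zm.
pose v l := pref_lhs l (@Auxvars R D t 0 0 0 (fun=> 0)
  (fun _ j => Num.max (m j) 0)).
pose a := @Auxvars R D t (\sum_l `|v l|) 0 0 (fun=> 0)
  (fun _ j => Num.max (m j) 0).
apply: le_lt_trans (@robust_risk_le _ _ _ D_ok t_range Z a _ _) (ltry _).
  split=> [k j|l]; first by rewrite le_max lexx orbT.
  have : v l <= \sum_l `|v l|.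
    rewrite (bigD1 l) //= (le_trans (ler_norm _)) // lerDl.
    by apply: sumr_ge0.
  by rewrite [v l]/v /pref_lhs /=; lra.
by move=> k j /=; rewrite add0r (le_trans (Zm j)) // lee_fin le_max lexx.
Qed.

Lemma stage_fin t (x : 'cV[R]_(xdim D t.-1)) (j : 'I_(nreal D t)) :
  (1 <= t <= horizon D)%N ->
  (forall y : 'cV[R]_(xdim D t), feasible y -> (future_cost y < +oo)%E) ->
  feasible x -> cost_to_go x (xi D t j) \is a fin_num.
Proof.
move=> t_range future_lt fx; case/andP: (t_range) => t1 tT.
have [[y xy] _] := complete_recourse D_ok t_range j fx.
have [g [G gGP]] := cost_to_go_affine_minorant j t_range.
rewrite fin_numE -ltNye -ltey (lt_le_trans (ltNyr _) (gGP x)) /= cost_to_goE //.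
apply: (@le_lt_trans _ _ ((mxdot (rcost (xi D t j)) y)%:E + future_cost y)%E).
  by apply: ge_ereal_inf; eexists; first by exists y.
rewrite lte_add_pinfty ?ltry //; apply: future_lt.
exact: feasible_stage t1 fx xy.
Qed.

Lemma cost_to_go_fin t (x : 'cV[R]_(xdim D t.-1)) (j : 'I_(nreal D t)) :
  (1 <= t <= horizon D)%N -> feasible x ->
  cost_to_go x (xi D t j) \is a fin_num.
Proof.
move=> /andP[t1 tT] fx.
have [k tk] : exists k, (t + k = horizon D)%N.
  by exists (horizon D - t)%N; rewrite subnKC.
elim: k t tk t1 tT x j fx => [|k IHk] t tk t1 tT x j fx.
  apply: stage_fin; rewrite ?t1 // => y fy.
  by rewrite /future_cost -tk addn0 eqxx lt0y.
have t_lt : (t < horizon D)%N by rewrite -tk addnS ltnS leq_addr.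
have tS_range : (2 <= t.+1 <= horizon D)%N by rewrite ltnS t1.
apply: stage_fin; rewrite ?t1 // => y fy.
rewrite /future_cost (ltn_eqF t_lt).
apply: (@robust_risk_lty t.+1 _
  (fun i => fine (cost_to_go (t := t.+1) y (xi D t.+1 i)))) => // i.
by rewrite fineK // IHk // addSn -addnS.
Qed.

Lemma stage_rhs_comb t (z : stage_real D t) (I : finType) (th : I -> R)
    (x : I -> 'cV[R]_(xdim D t.-1)) :
  \sum_i th i = 1 ->
  \sum_i th i *: stage_rhs (x i) z = stage_rhs (\sum_i th i *: x i) z.
Proof.
move=> th1; rewrite /stage_rhs; case: ifP => _.
  by rewrite -scaler_suml th1 scale1r.
under eq_bigr do rewrite scalerBr.
rewrite sumrB -scaler_suml th1 scale1r mulmx_sumr.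
by under [in RHS]eq_bigr do rewrite -scalemxAr.
Qed.

Lemma stage_set_comb t (z : stage_real D t) (I : finType) (th : I -> R)
    (x : I -> 'cV[R]_(xdim D t.-1)) (y : I -> 'cV[R]_(xdim D t)) :
  (forall i, 0 <= th i) -> \sum_i th i = 1 ->
  (forall i, stage_set (x i) z (y i)) ->
  stage_set (\sum_i th i *: x i) z (\sum_i th i *: y i).
Proof.
move=> th0 th1 xy; split=> [k|].
  rewrite summxE; apply: sumr_ge0 => i _; rewrite mxE mulr_ge0 //.
  by case: (xy i).
rewrite -stage_rhs_comb // mulmx_sumr; apply: eq_bigr => i _.
by rewrite -scalemxAr; have [_ ->] := xy i.
Qed.

(** Auxiliary variables certifying the risk at each of the given points combine
into a certificate at their convex combination. *)
Lemma robust_risk_convex t (I : finType) (th : I -> R)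
    (Z : I -> 'I_(nreal D t) -> R) (Z' : 'I_(nreal D t) -> \bar R) (r : I -> R) :
  (2 <= t <= horizon D)%N ->
  (forall i, 0 <= th i) -> \sum_i th i = 1 ->
  (forall i, (robust_risk (fun j => (Z i j)%:E) <= (r i)%:E)%E) ->
  (forall j, (Z' j <= (\sum_i th i * Z i j)%:E)%E) ->
  (robust_risk Z' <= (\sum_i th i * r i)%:E)%E.
Proof.
move=> t_range th0 th1 Zr Z'Z; apply/lee_addgt0Pr => eps eps0.
have [a aP] := choice (fun i => robust_risk_dual D_ok t_range (Zr i) eps0).
pose w := \sum_i th i *: aux_vec (a i).
have comb (F : auxvars D t -> R) : scalar (fun w => F (aux_of w)) ->
    F (aux_of w) = \sum_i th i * F (a i).
  by move=> /scalar_combE ->; apply: eq_bigr => i _; rewrite aux_vecK.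
apply: le_trans (@robust_risk_le _ _ _ D_ok t_range _ (aux_of w) _ _) _.
- split=> [k j|l].
    rewrite (comb (fun a => Delta a k j)); last exact: scalar_Delta.
    by apply: sumr_ge0 => i _; rewrite mulr_ge0 //; case: (aP i) => -[].
  rewrite -[leLHS]/(pref_lhs l (aux_of w)) (comb (pref_lhs l)).
    apply: sumr_le0 => i _; rewrite mulr_ge0_le0 //.
    by case: (aP i) => -[_ /(_ l)].
  exact: scalar_pref_lhs.
- move=> k j; apply: (le_trans (Z'Z j)); rewrite lee_fin.
  rewrite (comb (fun a => Delta a k j)); last exact: scalar_Delta.
  rewrite (comb (fun a => Defs.eta a k)); last exact: scalar_eta.
  rewrite -big_split /=; apply: ler_sum => i _; rewrite -mulrDr ler_wpM2l //.
  by have [_ /(_ k j) + _] := aP i; lra.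
- rewrite -EFinD lee_fin (comb (@aux_value _ _ _)); last exact: scalar_aux_value.
  rewrite -[X in _ + X]mul1r -th1 mulr_suml -big_split /=.
  by apply: ler_sum => i _; rewrite -mulrDr ler_wpM2l //; case: (aP i).
Qed.

(** Near-optimal decisions at the given points are averaged. *)
Lemma stage_convex t (z : stage_real D t) (I : finType) (th : I -> R)
    (x : I -> 'cV[R]_(xdim D t.-1)) (r : I -> R) :
  (1 <= t <= horizon D)%N ->
  (forall i, 0 <= th i) -> \sum_i th i = 1 ->
  (forall (y : I -> 'cV[R]_(xdim D t)) (s : I -> R),
    (forall i, (future_cost (y i) <= (s i)%:E)%E) ->
    (future_cost (\sum_i th i *: y i) <= (\sum_i th i * s i)%:E)%E) ->
  (forall i, (cost_to_go (x i) z <= (r i)%:E)%E) ->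
  (cost_to_go (\sum_i th i *: x i) z <= (\sum_i th i * r i)%:E)%E.
Proof.
move=> t_range th0 th1 future_convex xr; have tT : (t <= horizon D)%N.
  by case/andP: t_range.
apply/lee_addgt0Pr => eps eps0.
have /choice[y yP] : forall i, exists y, stage_set (x i) z y /\
    (future_cost y <= (r i + eps - mxdot (rcost z) y)%:E)%E.
  move=> i.
  have : (cost_to_go (x i) z < (r i + eps)%:E)%E.
    by apply: le_lt_trans (xr i) _; rewrite lte_fin ltrDl.
  rewrite cost_to_goE // => /ereal_inf_lt[_ [y xy <-]] /ltW y_le.
  by exists y; split=> //; rewrite EFinB leeBrDl // addeC.
have /future_convex y_conv := fun i => (yP i).2.
rewrite cost_to_goE //; apply: ge_ereal_inf; eexists.
  exists (\sum_i th i *: y i) => //.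
  by apply: stage_set_comb => // i; case: (yP i).
apply: le_trans (leeD2l _ y_conv) _; rewrite -!EFinD lee_fin.
rewrite (scalar_combE _ _ (scalar_mxdotr (rcost z))) -big_split /=.
rewrite -[X in _ <= _ + X]mul1r -th1 mulr_suml -big_split /=.
by apply: ler_sum => i _; rewrite -!mulrDr addrC subrK.
Qed.

Lemma cost_to_go_convex t (j : 'I_(nreal D t)) (I : finType) (th : I -> R)
    (x : I -> 'cV[R]_(xdim D t.-1)) (r : I -> R) :
  (1 <= t <= horizon D)%N ->
  (forall i, 0 <= th i) -> \sum_i th i = 1 ->
  (forall i, (cost_to_go (x i) (xi D t j) <= (r i)%:E)%E) ->
  (cost_to_go (\sum_i th i *: x i) (xi D t j) <= (\sum_i th i * r i)%:E)%E.
Proof.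
move=> /andP[t1 tT] th0 th1.
have [k tk] : exists k, (t + k = horizon D)%N.
  by exists (horizon D - t)%N; rewrite subnKC.
elim: k t tk t1 tT j x r => [|k IHk] t tk t1 tT j x r.
  apply: stage_convex; rewrite ?t1 // => y s.
  rewrite /future_cost -tk addn0 eqxx => s0; rewrite lee_fin.
  by apply: sumr_ge0 => i _; rewrite mulr_ge0 // -lee_fin.
have t_lt : (t < horizon D)%N by rewrite -tk addnS ltnS leq_addr.
have tS_range : (2 <= t.+1 <= horizon D)%N by rewrite ltnS t1.
apply: stage_convex; rewrite ?t1 // => y s.
rewrite /future_cost (ltn_eqF t_lt) => ys.
have [g gP] := choice (fun i => @cost_to_go_affine_minorant t.+1 i t_lt).
have [G GP] := choice gP.
have [Z ZE] := choice (fun i => robust_risk_fin D_ok tS_range (GP^~ (y i)) (ys i)).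
apply: (@robust_risk_convex t.+1 _ _ Z) => // [i|i'].
  by rewrite -ZE.
apply: IHk => // [|i]; first by rewrite addSn -addnS.
by have := congr1 (fun f => f i') (ZE i) => /= ->.
Qed.

End CostToGo.

(** * Lower approximations *)

(** Sets of pairs (decision, objective value) described by linear inequalities
in additional variables. *)
Definition polyhedral (R : realType) n (P : set ('cV[R]_n * R)) : Prop :=
  exists (V : lmodType R) (I : finType) (f : I -> V -> R) (b : I -> R)
    (p : V -> 'cV[R]_n) (c : V -> R),
  [/\ forall i, scalar (f i), linear p, scalar c &
      P = [set (p v, c v) | v in [set v | forall i, b i <= f i v]]%classic].

(** Strong duality when only the equality constraint is dualised; the remaining
constraints stay inside the Lagrangian. *)
Lemma polyhedral_duality (R : realType) n m (P : set ('cV[R]_n * R))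
    (A : 'M[R]_(m, n)) (d : 'cV[R]_m) (L : R) xv0 :
  polyhedral P -> P xv0 -> A *m xv0.1 = d ->
  (forall xv, P xv -> A *m xv.1 = d -> L <= xv.2) ->
  exists rho : 'cV[R]_m, forall xv, P xv ->
    L <= xv.2 + mxdot rho (d - A *m xv.1).
Proof.
move=> [V [I [f [b [p [c [hf hp hc ->]]]]]]] [v0 fv0 <-] /= Av0 PL.
have [|||rho rhoP] := @lagrange_duality R V I _ f b
  (fun i v => (A *m p v) i 0) (fun i => d i 0) c L v0 hf _ hc fv0.
- by move=> i a u v; rewrite hp mulmxDr -scalemxAr !mxE.
- by move=> i; rewrite Av0.
- move=> v fv Av; apply: (PL (p v, c v)); first by exists v.
  by apply/colP => i; rewrite /= Av.
exists (\col_i rho i) => _ [v fv <-] /=; rewrite mxdot_cvE.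
apply: le_trans (rhoP v fv) _; rewrite lerD2l; apply: ler_sum => i _.
by rewrite !mxE.
Qed.

Section LowerApproximation.
Variables (R : realType) (D : problem R) (C : cuts D).
Hypothesis D_ok : problem_ok D.

(** The additional variables are those of [aux_space]. *)
Lemma lower_points_polyhedral i t (z : stage_real D t) :
  polyhedral (lower_points C i z).
Proof.
have coord n (k : 'I_n) : scalar (fun y : 'cV[R]_n => y k 0).
  by move=> a u w; rewrite !mxE.
have [tT|tT] := boolP (t == horizon D).
  exists 'cV[R]_(xdim D t), 'I_(xdim D t), (fun k (y : 'cV[R]_(xdim D t)) => y k 0),
    (fun=> 0), id,
    (mxdot (rcost z)).
  split; [exact: coord|by []|exact: scalar_mxdotr|].
  apply/seteqP.
  split=> [[y v] [/= y0]|_ [y y0 <-]]; rewrite /lower_points /= tT //.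
  by move=> ->; exists y.
pose K := nreal D t.+1.
pose V : lmodType R := ('cV[R]_(xdim D t) * aux_space D t.+1)%type.
pose I : finType := ('I_(xdim D t) + ('I_K * 'I_K) + 'I_(nsupp D t.+1)
  + ('I_K * 'I_K * 'I_i.+1))%type.
pose f (k : I) (v : V) : R := match k with
  | inl (inl (inl k)) => v.1 k 0
  | inl (inl (inr kj)) => Delta (aux_of v.2) kj.1 kj.2
  | inl (inr l) => - pref_lhs l (aux_of v.2)
  | inr kjn => Defs.eta (aux_of v.2) kjn.1.1 + Delta (aux_of v.2) kjn.1.1 kjn.1.2
      - mxdot (cut_G C t.+1 kjn.1.2 kjn.2) v.1 end.
pose b (k : I) : R := match k with
  | inr kjn => cut_g C t.+1 kjn.1.2 kjn.2 | _ => 0 end.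
have lin1 : linear (fun v : V => v.1) by exact: linear_fst.
have lin2 : linear (fun v : V => v.2) by exact: linear_snd.
exists V, I, f, b, (fun v => v.1),
  (fun v => mxdot (rcost z) v.1 + aux_value (aux_of v.2)); split=> //.
- move=> [[[k|[k j]]|l]|[[k j] n]] /=.
  + exact: scalar_comp (coord _ k) lin1.
  + exact: scalar_comp (scalar_Delta k j) lin2.
  + exact: scalar_opp (scalar_comp (scalar_pref_lhs l) lin2).
  + apply: scalar_sub; last exact: scalar_comp (scalar_mxdotr _) lin1.
    apply: scalar_add; first exact: scalar_comp (scalar_eta k) lin2.
    exact: scalar_comp (scalar_Delta k j) lin2.
- apply: scalar_add; first exact: scalar_comp (scalar_mxdotr _) lin1.
  exact: scalar_comp (@scalar_aux_value _ _ _) lin2.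
- apply/seteqP; split=> [[y v] [/= y0]|_ [[y w] /= fyw <-]];
    rewrite /lower_points /= (negPf tT).
    move=> [a [[Da pa] cuta ->]]; exists (y, aux_vec a).
      move=> [[[k|[k j]]|l]|[[k j] n]] /=; rewrite ?aux_vecK //.
      + by rewrite oppr_ge0; exact: pa.
      + by have := cuta k j n (leq_ord n); lra.
    by rewrite /= aux_vecK approx_objectiveE.
  split=> [k|]; first exact: (fyw (inl (inl (inl k)))).
  exists (aux_of w); split; last by rewrite approx_objectiveE.
    split=> [k j|l]; first exact: (fyw (inl (inl (inr (k, j))))).
    by have := fyw (inl (inr l)); rewrite oppr_ge0.
  move=> k j n ni; have ni' : (n < i.+1)%N by [].
  have := fyw (inr (k, j, Ordinal ni')); rewrite /=; lra.
Qed.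

Lemma lower_valueE i t (x : 'cV[R]_(xdim D t.-1)) (z : stage_real D t) :
  lower_value C i x z = ereal_inf [set (xv.2)%:E | xv in
    [set xv | lower_points C i z xv /\ rA z *m xv.1 = stage_rhs x z]]%classic.
Proof.
rewrite /lower_value; case: ifP => // tT; rewrite cost_to_goE ?(eqP tT) //.
congr ereal_inf; apply/seteqP; rewrite /lower_points /future_cost tT.
split=> [_ [y [y0 Ay] <-]|_ [[y v] [[/= y0 ->] Ay] <-]].
  by exists (y, mxdot (rcost z) y) => //=; rewrite adde0.
by exists y => //; rewrite adde0.
Qed.

(** The Lagrangian at an optimal multiplier stays below the objective as the
right-hand side moves from [xhat] to [x], since only the multiplier term depends
on the incoming decision; strong duality makes it tight at [xhat]. *)
Lemma lower_value_subgradient i t (xhat x : 'cV[R]_(xdim D t.-1))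
    (z : stage_real D t) (rho : 'cV[R]_(nrows D t)) :
  (2 <= t)%N -> lower_value C i xhat z \is a fin_num ->
  optimal_multiplier C i xhat z rho ->
  (lower_value C i xhat z + (mxdot (- ((rE z)^T *m rho)) (x - xhat))%:E
    <= lower_value C i x z)%E.
Proof.
move=> t2 fin opt; set L := fine (lower_value C i xhat z).
have LE : lower_value C i xhat z = L%:E by rewrite fineK.
have Lle xv : lower_points C i z xv -> rA z *m xv.1 = stage_rhs xhat z ->
    L <= xv.2.
  move=> Pxv Axv; rewrite -lee_fin -LE lower_valueE.
  by apply: ereal_inf_lbound; exists xv.
have [xv0 [Pxv0 Axv0]] : exists xv, lower_points C i z xv /\
    rA z *m xv.1 = stage_rhs xhat z.
  have : (lower_value C i xhat z < +oo)%E by rewrite LE ltry.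
  by rewrite lower_valueE => /ereal_inf_lt[_ [xv xvP _] _]; exists xv.
have [rho' rho'P] :=
  polyhedral_duality (@lower_points_polyhedral i t z) Pxv0 Axv0 Lle.
have L_dual : (L%:E <= lower_dual C i xhat z rho)%E.
  apply: le_trans (opt rho'); apply: le_ereal_inf_tmp => _ [xv Pxv <-].
  by rewrite lee_fin; exact: rho'P.
rewrite [leRHS]lower_valueE; apply: le_ereal_inf_tmp => _ [xv [Pxv Axv] <-].
have : (L%:E <= (xv.2 + mxdot rho (stage_rhs xhat z - rA z *m xv.1))%:E)%E.
  by apply: le_trans L_dual _; apply: ereal_inf_lbound; exists xv.
rewrite LE -EFinD !lee_fin Axv /stage_rhs gtn_eqF //.
have -> : rrhs z - rE z *m xhat - (rrhs z - rE z *m x) = rE z *m (x - xhat).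
  by rewrite mulmxBr opprB [LHS]addrC addrA subrK.
rewrite -mxdot_trmul (scalarNE _ (scalar_mxdotl _)); lra.
Qed.

Definition cuts_valid t : Prop :=
  forall n (j : 'I_(nreal D t)) (x : 'cV[R]_(xdim D t.-1)), feasible x ->
    ((cut_g C t j n + mxdot (cut_G C t j n) x)%:E
      <= cost_to_go x (xi D t j))%E.

(** A near-optimal decision of the true problem, completed by auxiliary variables
from the strong duality of the risk measure, satisfies the cut constraints as
soon as the cuts lie below the true cost-to-go functions. *)
Lemma lower_value_le i t (x : 'cV[R]_(xdim D t.-1)) (j : 'I_(nreal D t)) :
  (1 <= t <= horizon D)%N -> ((t < horizon D)%N -> cuts_valid t.+1) ->
  feasible x ->
  (lower_value C i x (xi D t j) <= cost_to_go x (xi D t j))%E.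
Proof.
move=> t_range valid fx; case/andP: (t_range) => t1 tT.
have [tE|t_neq] := boolP (t == horizon D); first by rewrite /lower_value tE.
have t_lt : (t < horizon D)%N by rewrite ltn_neqAle t_neq.
have tS_range : (2 <= t.+1 <= horizon D)%N by rewrite ltnS t1.
rewrite cost_to_goE //; apply: le_ereal_inf_tmp => _ [y xy <-].
have fy : feasible y := feasible_stage t1 fx xy.
have := future_cost_gtNy D_ok y t_range.
case futE : (future_cost y) => [r| |] // _; last by rewrite addey ?leey.
move: futE; rewrite /future_cost (negPf t_neq) => futE.
have yfin k := @cost_to_go_fin _ _ D_ok t.+1 y k t_lt fy.
have : (robust_risk (fun k => (fine (cost_to_go (t := t.+1) y (xi D t.+1 k)))%:E)
    <= r%:E)%E.
  by rewrite -futE; under eq_fun do rewrite fineK //.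
move=> riskr; apply/lee_addgt0Pr => eps eps0.
have [a [prefa Za obja]] := robust_risk_dual D_ok tS_range riskr eps0.
rewrite lower_valueE; apply: ge_ereal_inf; eexists.
  exists (y, approx_objective (xi D t j) y a) => //; case: xy => y0 Ay.
  split=> //; split=> //=; rewrite (negPf t_neq); exists a; split=> // k j' n _.
  have := valid t_lt n j' y fy; rewrite -[leRHS](fineK (yfin j')) lee_fin.
  have := Za k j'; lra.
rewrite /= approx_objectiveE -!EFinD lee_fin; lra.
Qed.

Lemma cuts_valid_step (xhat : nat -> forall t, 'cV[R]_(xdim D t)) t :
  sddp_run xhat C -> (2 <= t <= horizon D)%N ->
  ((t < horizon D)%N -> cuts_valid t.+1) -> cuts_valid t.
Proof.
move=> run t_range valid [|n] j x fx; case/andP: (t_range) => t2 tT.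
  have [-> g_le] := initial_cut run t_range j.
  by rewrite (scalar0E (scalar_mxdotl x)) addr0 g_le.
have t_range1 : (1 <= t <= horizon D)%N by rewrite (ltnW t2).
apply: le_trans (@lower_value_le n.+1 t x j t_range1 valid fx).
have [rho [opt GE gE]] := backward_pass run (ltn0Sn n) t_range j.
have fin : lower_value C n.+1 (xhat n.+1 t.-1) (xi D t j) \is a fin_num.
  by move: gE; case: (lower_value _ _ _ _).
apply: le_trans (lower_value_subgradient x t2 fin opt).
rewrite -GE EFinD gE (scalarDE _ _ (scalar_mxdotr _)).
move: fin; case: (lower_value _ _ _ _) => // r _.
rewrite -EFinB -!EFinD lee_fin (scalarNE _ (scalar_mxdotr _)); lra.
Qed.

Lemma sddp_cuts_valid (xhat : nat -> forall t, 'cV[R]_(xdim D t)) t :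
  sddp_run xhat C -> (2 <= t <= horizon D)%N -> cuts_valid t.
Proof.
move=> run /andP[t2 tT].
have [k tk] : exists k, (t + k = horizon D)%N.
  by exists (horizon D - t)%N; rewrite subnKC.
elim: k t tk t2 tT => [|k IHk] t tk t2 tT.
  by apply: cuts_valid_step run _ _; rewrite ?t2 // -tk addn0 ltnn.
apply: cuts_valid_step run _ _; rewrite ?t2 // => t_lt.
by apply: IHk => //; rewrite ?addSn -?addnS // ltnW.
Qed.

End LowerApproximation.

(** * Upper approximations *)

Section UpperApproximation.
Variables (R : realType) (D : problem R).
Hypothesis D_ok : problem_ok D.

Lemma sddp_feasible (xhat : nat -> forall t, 'cV[R]_(xdim D t)) (C : cuts D) i t :
  sddp_run xhat C -> (1 <= i)%N -> (t <= horizon D)%N -> feasible (xhat i t).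
Proof.
move=> run i1; elim: t => [_|t IHt tT]; first exact: forward_start run _ i1.
have [j [v [[y0 _] Ay _]]] := forward_pass run i1 (t := t.+1) tT.
by exists (xhat i t); split; [exact: IHt (ltnW tT)|exists j].
Qed.

Lemma cost_to_go_lipschitz t (j : 'I_(nreal D t)) (M : R)
    (x y : 'cV[R]_(xdim D t.-1)) :
  0 <= M -> (lipschitz_modulus D t <= M%:E)%E ->
  cost_to_go x (xi D t j) \is a fin_num ->
  cost_to_go y (xi D t j) \is a fin_num ->
  (cost_to_go x (xi D t j)
    <= cost_to_go y (xi D t j) + (M * norm1 (x - y))%:E)%E.
Proof.
move=> M0 lipM xfin yfin; have n0 : 0 <= norm1 (x - y) by apply: sumr_ge0.
have [<-|xy] := eqVneq x y.
  by rewrite leeDl // lee_fin mulr_ge0 // sumr_ge0.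
have n_gt0 : 0 < norm1 (x - y).
  rewrite lt_neqAle n0 andbT eq_sym; apply: contra xy.
  rewrite psumr_eq0 // => /allP xy0; apply/eqP/colP => i; apply/eqP.
  rewrite -subr_eq0 -normr_eq0.
  by have := xy0 i; rewrite mem_index_enum !mxE => /(_ isT).
have : ((`|fine (cost_to_go x (xi D t j)) - fine (cost_to_go y (xi D t j))|
    / norm1 (x - y))%:E <= M%:E)%E.
  by apply: le_trans lipM; apply: ereal_sup_ubound; exists j, x, y.
rewrite lee_fin ler_pdivrMr // => /(le_trans (ler_norm _)) xyM.
by rewrite -[leLHS]fineK // -(fineK yfin) -EFinD lee_fin; lra.
Qed.

(** Convexity bounds the cost at a mixture of the trial points, and the Lipschitz
term pays for the remaining displacement [d]. *)
Lemma cost_to_go_interpolation t (j : 'I_(nreal D t)) (M : R) (I : finType)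
    (th : I -> R) (x : I -> 'cV[R]_(xdim D t.-1)) (d y : 'cV[R]_(xdim D t.-1))
    (u : I -> \bar R) (w : R) :
  (1 <= t <= horizon D)%N -> 0 <= M -> (lipschitz_modulus D t <= M%:E)%E ->
  (forall i, feasible (x i)) -> feasible y ->
  (forall i, (cost_to_go (x i) (xi D t j) <= u i)%E) ->
  (forall i, 0 <= th i) -> \sum_i th i = 1 -> \sum_i th i *: x i + d = y ->
  (\sum_i (th i)%:E * u i + (M * norm1 d)%:E)%E = w%:E ->
  (cost_to_go y (xi D t j) <= w%:E)%E.
Proof.
move=> t_range M0 lipM fx fy xu th0 th1 yE wE.
have xfin i := cost_to_go_fin D_ok j t_range (fx i).
have mix_le : (cost_to_go (\sum_i th i *: x i) (xi D t j)
    <= (\sum_i th i * fine (cost_to_go (x i) (xi D t j)))%:E)%E.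
  by apply: cost_to_go_convex => // i; rewrite fineK.
have mix_fin : cost_to_go (\sum_i th i *: x i) (xi D t j) \is a fin_num.
  have [g [G gGP]] := cost_to_go_affine_minorant D_ok j t_range.
  rewrite fin_numE -ltNye -ltey (lt_le_trans (ltNyr _) (gGP _)) /=.
  exact: le_lt_trans mix_le (ltry _).
have := cost_to_go_lipschitz M0 lipM (cost_to_go_fin D_ok j t_range fy) mix_fin.
rewrite -{2}yE addrAC subrr add0r => /le_trans; apply.
rewrite -wE leeD2r // (le_trans mix_le) // -sumEFin; apply: lee_sum => i _.
by rewrite EFinM; apply: lee_wpmul2l; rewrite ?lee_fin // fineK.
Qed.

(** Every point of the upper problem yields a certificate for the risk of the true
next-stage costs. *)
Lemma upper_value_ge (M : nat -> R) (xhat : nat -> forall t, 'cV[R]_(xdim D t))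
    i k t (x : 'cV[R]_(xdim D t.-1)) (j : 'I_(nreal D t)) :
  (forall t, (1 <= t <= horizon D)%N -> 0 < M t) ->
  (forall t, (1 <= t <= horizon D)%N -> (lipschitz_modulus D t <= (M t)%:E)%E) ->
  (forall n t, (1 <= n)%N -> (t <= horizon D)%N -> feasible (xhat n t)) ->
  (t + k = horizon D)%N -> (1 <= t)%N -> feasible x ->
  (cost_to_go x (xi D t j) <= upper_value_rec M xhat i k x (xi D t j))%E.
Proof.
move=> M_gt0 M_lip fxhat.
elim: k t x j => [|k IHk] t x j tk t1 fx //=.
have t_lt : (t < horizon D)%N by rewrite -tk addnS ltnS leq_addr.
have tS_range : (2 <= t.+1 <= horizon D)%N by rewrite ltnS t1.
apply: le_ereal_inf_tmp => _ [y [a [w [th [d [xy prefa wa combs ->]]]]]].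
rewrite cost_to_goE ?(ltnW t_lt) // approx_objectiveE.
apply: ge_ereal_inf; eexists; first by exists y.
rewrite EFinD leeD2l // /future_cost ltn_eqF //.
apply: (robust_risk_le D_ok tS_range prefa) => k' j'.
have wj : (w j' <= Defs.eta a k' + Delta a k' j') by have := wa k' j'; lra.
apply: (@le_trans _ _ (w j')%:E); last by rewrite lee_fin.
have [th0 wE yE th1] := combs j'.
apply: (cost_to_go_interpolation (t := t.+1) (M := M t.+1) _ _ _ _ _ _ th0 th1 yE wE) => //.
- exact: ltW (M_gt0 t.+1 _).
- exact: M_lip.
- by move=> n; apply: fxhat => //; exact: ltnW.
- exact: feasible_stage t1 fx xy.
- move=> n; apply: IHk; rewrite ?addSn -?addnS //.
  by apply: fxhat => //; exact: ltnW.
Qed.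

End UpperApproximation.

Theorem theorem4p1 (R : realType) (D : problem R)
    (xhat : nat -> forall t, 'cV[R]_(xdim D t)) (C : cuts D) (M : nat -> R)
    (D_ok : problem_ok D) (run : sddp_run xhat C)
    (M_gt0 : forall t, (1 <= t <= horizon D)%N -> 0 < M t)
    (M_lip : forall t, (1 <= t <= horizon D)%N ->
       (lipschitz_modulus D t <= (M t)%:E)%E)
    (i : nat) (i_ge1 : (1 <= i)%N)
    (t : nat) (t_range : (1 <= t <= (horizon D).-1)%N)
    (x : 'cV[R]_(xdim D t)) (x_feasible : feasible x)
    (j : 'I_(nreal D t.+1)) :
  (lower_value (t := t.+1) C i x (xi D t.+1 j)
     <= cost_to_go (t := t.+1) x (xi D t.+1 j))%E /\
  (cost_to_go (t := t.+1) x (xi D t.+1 j)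
     <= upper_value (t := t.+1) M xhat i x (xi D t.+1 j))%E.
Proof.
have tT : (t < horizon D)%N.
  case/andP: t_range => _; rewrite -ltnS prednK //.
  exact: ltnW (horizon_gt1 D_ok).
split.
  apply: lower_value_le => //= t_lt.
  exact: sddp_cuts_valid run _.
apply: (@upper_value_ge _ _ D_ok M xhat i _ t.+1) => //.
  by move=> n s n1 sT; exact: sddp_feasible run n1 sT.
by rewrite subnKC.
Qed.
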